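(* There exists an analytic stationary profile $(\rho_s(z),U_s(z))$, $z\in[-1,1]$, with $\rho_s'(z)<0$, satisfying $$0<\frac{-\rho_s'(z)}{|U_s'(z)|^2}<\frac14,$$ and such that the following holds. There exists $\overline M>0$ such that for any $M>\overline M$, the linearized Euler-Boussinesq operator $\mathscr B_{\rho_s,U_s}$ on $\mathbb T_M\times(-1,1)$ has an eigenvalue $\lambda\in\mathbb C$ with $\mathrm{Re}(\lambda)>0$. Moreover, there exists an associated eigenfunction of the form $$\varrho(x,z)=\widehat\varrho(z)e^{i\frac kMx},\qquad \omega(x,z)=\widehat\omega(z)e^{i\frac kMx}$$ for some smooth nonzero functions $\widehat\varrho(z),\widehat\omega(z)$ and some $k\in\mathbb Z\setminus\{0\}$.
   Context: For $M>0$, $\mathbb T_M=\mathbb R/(2\pi M\mathbb Z)$. The linearization around $(\rho_s(z),U_s(z))$ of the (unscaled) two-dimensional Euler-Boussinesq system in density-vorticity form on $\mathbb T_M\times(-1,1)$ is $\partial_t(\varrho,\omega)=\mathscr B_{\rho_s,U_s}(\varrho,\omega)$ with $$\mathscr B_{\rho_s,U_s}\begin{pmatrix}\varrho\\\omega\end{pmatrix}=\begin{pmatrix}-U_s(z)\partial_x\varrho+\rho_s'(z)\partial_x\varphi\\-U_s(z)\partial_x\omega+U_s''(z)\partial_x\varphi+\partial_x\varrho\end{pmatrix},\qquad \Delta\varphi=\omega,\ \ \varphi|_{z=\pm1}=0,$$ where $\Delta=\partial_x^2+\partial_z^2$. *)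

(* Defs.v *)
From Stdlib Require Import Reals ZArith.
From Coquelicot Require Import Coquelicot.
Open Scope R_scope.

(* Real-analytic on [-1,1]: every point of the closed interval, endpoints
   included, has a full neighbourhood in R on which f is the sum of a convergent
   power series, i.e. f is the restriction of a function analytic near [-1,1]. *)
Definition analytic_on_channel (f : R -> R) : Prop :=
  forall z0 : R, -1 <= z0 <= 1 ->
  exists (a : nat -> R) (r : R), 0 < r /\
    forall z : R, Rabs (z - z0) < r -> is_pseries a (z - z0) (f z).

(* C^infinity([-1,1]; C), as restrictions of functions that are smooth on an
   open interval containing [-1,1]. *)
Definition smooth_profile (f : R -> C) : Prop :=
  exists d : R, 0 < d /\
    forall (n : nat) (z : R), -1 - d < z < 1 + d ->
      ex_derive_n (fun t => Re (f t)) n z /\ ex_derive_n (fun t => Im (f t)) n z.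

(* A function on T_M x [-1,1] is encoded as f : R -> R -> C, with f x z
   (2 pi M)-periodic in x; the values of f outside |z| <= 1 are irrelevant except
   that, as above, they witness smoothness up to the boundary. *)
Definition smooth_field (M : R) (f : R -> R -> C) : Prop :=
  (forall x z : R, -1 <= z <= 1 -> f (x + 2 * PI * M) z = f x z) /\
  exists d : R, 0 < d /\
    forall (n : nat) (x z : R), -1 - d < z < 1 + d ->
      ex_diff_n (fun u v => Re (f u v)) n x z /\
      ex_diff_n (fun u v => Im (f u v)) n x z.

(* Derivative in a real variable of a complex-valued function; like [Derive], it
   is meaningful only where the derivative exists. *)
Definition CDerive (f : R -> C) (t : R) : C :=
  (Derive (fun s => Re (f s)) t, Derive (fun s => Im (f s)) t).

Definition dx (f : R -> R -> C) : R -> R -> C :=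
  fun x z => CDerive (fun t => f t z) x.

Definition dz (f : R -> R -> C) : R -> R -> C :=
  fun x z => CDerive (fun t => f x t) z.

Definition laplacian (f : R -> R -> C) : R -> R -> C :=
  fun x z => Cplus (dx (dx f) x z) (dz (dz f) x z).

Definition stream_function (M : R) (omega phi : R -> R -> C) : Prop :=
  smooth_field M phi /\
  (forall x z : R, -1 < z < 1 -> laplacian phi x z = omega x z) /\
  (forall x : R, phi x (-1) = RtoC 0 /\ phi x 1 = RtoC 0).

(* The graph of B_{rho_s,U_s} on smooth fields: (r, w) is the image of
   (rho, omega).  The stream function phi, hence also (r, w) on the open channel,
   is determined by omega because the Dirichlet problem has a unique solution. *)
Definition boussinesq (M : R) (rhos Us : R -> R)
    (rho omega r w : R -> R -> C) : Prop :=
  exists phi : R -> R -> C,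
    stream_function M omega phi /\
    forall x z : R, -1 < z < 1 ->
      r x z = (- RtoC (Us z) * dx rho x z
               + RtoC (Derive rhos z) * dx phi x z)%C /\
      w x z = (- RtoC (Us z) * dx omega x z
               + RtoC (Derive_n Us 2 z) * dx phi x z
               + dx rho x z)%C.

Definition eigenfunction (M : R) (rhos Us : R -> R) (lambda : C)
    (rho omega : R -> R -> C) : Prop :=
  smooth_field M rho /\ smooth_field M omega /\
  (exists x z : R, -1 <= z <= 1 /\
     (rho x z <> RtoC 0 \/ omega x z <> RtoC 0)) /\
  boussinesq M rhos Us rho omega
    (fun x z => (lambda * rho x z)%C) (fun x z => (lambda * omega x z)%C).

Definition eigenvalue (M : R) (rhos Us : R -> R) (lambda : C) : Prop :=
  exists rho omega : R -> R -> C, eigenfunction M rhos Us lambda rho omega.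

Definition nonzero_profile (f : R -> C) : Prop :=
  exists z : R, -1 <= z <= 1 /\ f z <> RtoC 0.

(* exp (i t) for real t *)
Definition expi (t : R) : C := (cos t, sin t).

(* The field f(z) e^{i (k/M) x} *)
Definition fourier_mode (M : R) (k : Z) (f : R -> C) : R -> R -> C :=
  fun x z => (f z * expi (IZR k / M * x))%C.

(* Main.v *)
(** Take [rho_s = - eps z] and the odd monotone shear [U = z / (z^2 + 3/2)], and look for
    a purely imaginary phase speed [c = i s], i.e. for the real eigenvalue
    [lambda = alpha s] with [alpha = k / M], [k = 1].  The stream function profile solves
    the Taylor-Goldstein equation
      [y'' = (alpha^2 + U''/(U - i s) - eps/(U - i s)^2) y],  [y (-1) = y 1 = 0].
    Shoot from [z = -1].  Because [U] is odd, [z |-> conj (y (-z))] is another solution,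
    and a Wronskian argument shows that [y 1] is real: an eigenvalue is a sign change of
    the real function [s |-> y 1].  For [alpha = eps = 0] the equation has the solution
    [U - i s], whence [y 1 = - (U(1)^2 + s^2) * int_{-1}^1 (U - i s)^(-2)]; this is positive
    for [s = 1] and negative for [s = 1/250].  Both signs survive for small [alpha] and
    [eps], and the intermediate value theorem gives an unstable mode for every
    sufficiently large [M], while a small [eps] makes the Richardson number smaller
    than [1/4]. *)

Require Import Defs.
From Stdlib Require Import Reals ZArith Lra Lia.
From Stdlib Require Import IndefiniteDescription FunctionalExtensionality.
From Coquelicot Require Import Coquelicot.
Open Scope R_scope.

(** * The Cauchy problem for globally Lipschitz vector fields *)

(** The shear is dictated by the limit of small [s]. For U = z / (z^2 + c) one has U^(-2) = z^2 + 2
    c + c^2 / z^2, whose Hadamard finite part over [-1, 1] is 2/3 + 4 c - 2 c^2. It is positive for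
    0 < c < 1 + 2 / sqrt 3, whereas Couette flow U = z gives -2: the profile has to flatten towards
    the walls for the integral to change sign. A finite Richardson number needs U' to have no zero
    on [-1, 1], that is c > 1 here. The value c = 3/2 meets both conditions.

    The coefficients blow up near z = 0 as [s] tends to 0, so [s] is kept above a fixed positive
    number. All denominators then stay away from 0 on the whole real line; the equation is solved
    there, with coefficients bounded in z, and the walls need no one-sided calculus. A single
    Gronwall estimate, linear in the change of the coefficients, gives both continuity in [s] and
    the comparison with alpha = eps = 0. *)

Lemma minus_plus_l {G : AbelianGroup} (v x y : G) :
  minus (plus v x) (plus v y) = minus x y.
Proof.
unfold minus; rewrite opp_plus, (plus_comm v x), <- plus_assoc, (plus_assoc v).
now rewrite plus_opp_r, plus_zero_l.
Qed.

Lemma plus_minus_cancel {G : AbelianGroup} (v x : G) : minus (plus v x) v = x.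
Proof.
unfold minus; rewrite (plus_comm v x), <- plus_assoc.
exact (eq_trans (f_equal (plus x) (plus_opp_r v)) (plus_zero_r x)).
Qed.

Lemma minus_zero_eq {G : AbelianGroup} (x y : G) : minus x y = zero -> x = y.
Proof.
intros H; apply (plus_reg_r (opp y)).
exact (eq_trans H (eq_sym (plus_opp_r y))).
Qed.

Section Picard.

Context {V : CompleteNormedModule R_AbsRing}.
Variables (F : R -> V -> V) (a : R) (v0 : V) (K B : R).
Hypothesis K_pos : 0 < K.
Hypothesis F_lip : forall t v w, norm (minus (F t v) (F t w)) <= K * norm (minus v w).
Hypothesis F_cont : forall Y : R -> V,
  (forall t, continuous Y t) -> forall t, continuous (fun u => F u (Y u)) t.
Hypothesis F_init : forall t, norm (F t v0) <= B.

(* In the norm weighted by [1 / wt], one Picard step contracts by the factor [1/2]. *)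
Let wt (t : R) : R := exp (2 * K * Rabs (t - a)).

Lemma wt_ge1 t : 1 <= wt t.
Proof.
unfold wt; rewrite <- exp_0 at 1.
pose proof (Rabs_pos (t - a)).
destruct (Rle_lt_or_eq_dec 0 (2 * K * Rabs (t - a))) as [H1|H1]; try nra.
- left; now apply exp_increasing.
- rewrite <- H1; lra.
Qed.

Lemma norm_minus_sym (x y : V) : norm (minus x y) = norm (minus y x).
Proof.
rewrite <- (opp_minus x y).
exact (eq_sym (norm_opp (minus x y))).
Qed.

Lemma norm_minus_triangle (x y z : V) :
  norm (minus x z) <= norm (minus x y) + norm (minus y z).
Proof.
rewrite (minus_trans y x z).
exact (norm_triangle (minus x y) (minus y z)).
Qed.

(** Balls and norm determine each other only up to [norm_factor]; this is why radii are divided by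
    it below. *)
Lemma ball_norm (x y : V) (e : posreal) :
  ball x e y -> norm (minus y x) < @norm_factor _ V * e.
Proof. exact (norm_compat2 x y e). Qed.

Lemma norm_ball (x y : V) (e : posreal) : norm (minus y x) < e -> ball x e y.
Proof. exact (norm_compat1 x y e). Qed.

(** The weight grows at rate 2 K, so integrating K c [wt] away from [a] gives c / 2 times
    [wt t - 1]: this is the source of the contraction factor. The sides t >= a and t < a are treated
    separately because of the absolute value. *)
Lemma norm_RInt_exp_weight (f : R -> V) (c t : R) :
  0 <= c -> (forall u, continuous f u) ->
  (forall u, norm (f u) <= K * c * wt u) ->
  norm (RInt f a t) <= c / 2 * wt t.
Proof.
intros Hc Hf Hb.
assert (Hex : forall x y, ex_RInt f x y) by (intros; apply ex_RInt_continuous; auto).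
destruct (Rle_dec a t) as [Hat|Hat].
- apply Rle_trans with (c / 2 * exp (2 * K * (t - a)) - c / 2 * exp (2 * K * (a - a))).
  + apply (norm_RInt_le f (fun u => K * c * exp (2 * K * (u - a))) a t); auto.
    * intros u Hu; specialize (Hb u); unfold wt in Hb.
      rewrite Rabs_pos_eq in Hb; lra.
    * now apply RInt_correct.
    * apply (is_RInt_derive (fun u => c / 2 * exp (2 * K * (u - a)))).
      -- intros u _; auto_derive; auto; unfold Rminus; field.
      -- intros u _; apply (ex_derive_continuous (V := R_NormedModule)); auto_derive; auto.
  + unfold wt; rewrite (Rabs_pos_eq (t - a)) by lra.
    pose proof (exp_pos (2 * K * (a - a))); nra.
- rewrite <- (opp_RInt_swap f) by auto.
  apply Rle_trans with (norm (RInt f t a)); [right; exact (norm_opp (RInt f t a))|].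
  apply Rle_trans with (- (c / 2) * exp (2 * K * (a - a)) - - (c / 2) * exp (2 * K * (a - t))).
  + apply (norm_RInt_le f (fun u => K * c * exp (2 * K * (a - u))) t a); auto; try lra.
    * intros u Hu; specialize (Hb u); unfold wt in Hb.
      rewrite Rabs_left1 in Hb by lra.
      replace (a - u) with (- (u - a)) by ring; lra.
    * now apply RInt_correct.
    * apply (is_RInt_derive (fun u => - (c / 2) * exp (2 * K * (a - u)))).
      -- intros u _; auto_derive; auto; unfold Rminus; field.
      -- intros u _; apply (ex_derive_continuous (V := R_NormedModule)); auto_derive; auto.
  + unfold wt; rewrite (Rabs_left1 (t - a)) by lra.
    replace (- (t - a)) with (a - t) by ring.
    pose proof (exp_pos (2 * K * (a - a))); nra.
Qed.

Fixpoint picard (n : nat) : R -> V :=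
  match n with
  | O => fun _ => v0
  | S m => fun t => plus v0 (RInt (fun u => F u (picard m u)) a t)
  end.

Lemma is_derive_integral_eq (Y : R -> V) t :
  (forall t, continuous Y t) ->
  is_derive (fun t => plus v0 (RInt (fun u => F u (Y u)) a t)) t (F t (Y t)).
Proof.
intros HY.
assert (HF := F_cont Y HY).
evar_last.
- apply @is_derive_plus.
  + apply @is_derive_const.
  + apply (is_derive_RInt (fun u => F u (Y u)) _ a t).
    * apply filter_forall; intros y; apply RInt_correct, ex_RInt_continuous; auto.
    * apply HF.
- now rewrite plus_zero_l.
Qed.

Lemma picard_continuous n t : continuous (picard n) t.
Proof.
revert t; induction n as [|n IH]; intros t.
- apply continuous_const.
- apply (ex_derive_continuous (V := CompleteNormedModule.NormedModule R_AbsRing V)).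
  eexists; now apply is_derive_integral_eq.
Qed.

Lemma integral_eq_contract (Y Z : R -> V) (c t : R) :
  0 <= c -> (forall t, continuous Y t) -> (forall t, continuous Z t) ->
  (forall t, norm (minus (Y t) (Z t)) <= c * wt t) ->
  norm (minus (plus v0 (RInt (fun u => F u (Y u)) a t))
              (plus v0 (RInt (fun u => F u (Z u)) a t))) <= c / 2 * wt t.
Proof.
intros Hc HY HZ H.
assert (HFY := F_cont Y HY); assert (HFZ := F_cont Z HZ).
replace (minus _ _) with (RInt (fun u => minus (F u (Y u)) (F u (Z u))) a t).
- apply norm_RInt_exp_weight; auto.
  + intros u; now apply (continuous_minus (V := V)).
  + intros u; eapply Rle_trans; [apply F_lip|].
    specialize (H u); nra.
- assert (E : RInt (fun u => minus (F u (Y u)) (F u (Z u))) a t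
     = minus (RInt (fun u => F u (Y u)) a t) (RInt (fun u => F u (Z u)) a t))
    by (apply (RInt_minus (V := V)); apply ex_RInt_continuous; auto).
  rewrite E.
  symmetry; exact (minus_plus_l (G := CompleteNormedModule.AbelianGroup R_AbsRing V) _ _ _).
Qed.

(** Chosen so that B <= K C0, which puts the bound on the first increment in the form required by
    [norm_RInt_exp_weight]. *)
Let C0 : R := Rmax 0 (B / K).

Lemma picard_step n t :
  norm (minus (picard (S n) t) (picard n t)) <= C0 * (/ 2) ^ n * wt t.
Proof.
assert (HC : 0 <= C0) by apply Rmax_l.
revert t; induction n as [|n IH]; intros t.
- replace (minus _ _) with (RInt (fun u => F u v0) a t).
  + eapply Rle_trans; [apply (norm_RInt_exp_weight _ C0)|]; auto.
    * apply (F_cont (fun _ => v0)); intros; apply continuous_const.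
    * intros u; apply Rle_trans with (1 := F_init u).
      assert (B / K <= C0) by apply Rmax_r.
      assert (B <= K * C0) by (replace B with (K * (B / K)) by (field; lra); nra).
      assert (0 <= K * C0) by nra.
      pose proof (wt_ge1 u); nra.
    * pose proof (wt_ge1 t); simpl; nra.
  + symmetry; exact (plus_minus_cancel (G := CompleteNormedModule.AbelianGroup R_AbsRing V) _ _).
- eapply Rle_trans.
  + apply (integral_eq_contract (picard (S n)) (picard n) (C0 * (/ 2) ^ n)).
    * assert (0 < (/ 2) ^ n) by (apply pow_lt; lra); nra.
    * intros; apply picard_continuous.
    * intros; apply picard_continuous.
    * apply IH.
  + simpl; lra.
Qed.

Lemma picard_diff n k t :
  norm (minus (picard (n + k) t) (picard n t)) <= 2 * C0 * (/ 2) ^ n * wt t.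
Proof.
assert (HC : 0 <= C0) by apply Rmax_l.
(* Subtracting the tail of the geometric series makes the induction on [k] close exactly. *)
assert (H : norm (minus (picard (n + k) t) (picard n t))
   <= 2 * C0 * (/ 2) ^ n * wt t - 2 * C0 * (/ 2) ^ (n + k) * wt t).
{ induction k as [|k IH].
  - rewrite Nat.add_0_r.
    replace (minus (picard n t) (picard n t)) with (zero : V)
      by (symmetry; exact (plus_opp_r (picard n t))).
    rewrite (norm_zero : norm (zero : V) = 0); lra.
  - eapply Rle_trans; [apply (norm_minus_triangle _ (picard (n + k) t))|].
    replace (n + S k)%nat with (S (n + k)) by lia.
    pose proof (picard_step (n + k) t) as Hs.
    rewrite <- (tech_pow_Rmult (/ 2) (n + k)); lra. }
assert (0 < (/ 2) ^ (n + k)) by (apply pow_lt; lra).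
pose proof (wt_ge1 t).
assert (0 <= C0 * (/ 2) ^ (n + k) * wt t) by (apply Rmult_le_pos; [apply Rmult_le_pos|]; lra).
lra.
Qed.

Lemma half_pow_small c e : 0 < e -> exists n, c * (/ 2) ^ n < e.
Proof.
intros He.
assert (H : is_lim_seq (fun n => c * (/ 2) ^ n) (Finite (c * 0))).
{ apply (is_lim_seq_scal_l _ c (Finite 0)), is_lim_seq_geom.
  rewrite Rabs_pos_eq; lra. }
rewrite Rmult_0_r in H.
apply is_lim_seq_spec in H.
destruct (H (mkposreal e He)) as [n Hn].
exists n; specialize (Hn n (le_n n)); simpl in Hn.
rewrite Rminus_0_r in Hn; apply Rabs_def2 in Hn; lra.
Qed.

(** The limit is taken pointwise in [t]; the weighted rate is kept because [wt] is bounded near each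
    point, so convergence is locally uniform and continuity passes to [Y]. *)
Lemma picard_limit :
  exists Y : R -> V, forall n t, norm (minus (Y t) (picard n t)) <= 2 * C0 * (/ 2) ^ n * wt t.
Proof.
assert (HL : forall t, exists y : V, filterlim (fun n => picard n t) eventually (locally y)).
{ intros t.
  apply (filterlim_locally_cauchy (U := CompleteNormedModule.CompleteSpace R_AbsRing V)
    (F := eventually)); intros e.
  destruct (half_pow_small (2 * (2 * C0 * wt t)) e (cond_pos e)) as [N HN].
  exists (fun n => (N <= n)%nat); split; [now exists N|].
  intros u v Hu Hv; apply norm_ball.
  eapply Rle_lt_trans; [apply (norm_minus_triangle _ (picard N t))|].
  rewrite (norm_minus_sym (picard N t)).
  pose proof (picard_diff N (u - N) t); pose proof (picard_diff N (v - N) t).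
  replace (N + (u - N))%nat with u in * by lia.
  replace (N + (v - N))%nat with v in * by lia. lra. }
destruct (functional_choice _ HL) as [Y HY]; exists Y; intros n t.
apply le_epsilon; intros e He.
pose proof (@norm_factor_gt_0 _ V) as Hnf.
assert (He' : 0 < e / @norm_factor _ V) by (apply Rdiv_lt_0_compat; auto).
destruct (proj1 (filterlim_locally _ _) (HY t) (mkposreal _ He')) as [N HN].
specialize (HN (n + N)%nat ltac:(lia)).
apply ball_norm in HN; simpl in HN.
replace (norm_factor * (e / norm_factor)) with e in HN by (field; lra).
eapply Rle_trans; [apply (norm_minus_triangle _ (picard (n + N) t))|].
rewrite (norm_minus_sym (Y t)).
pose proof (picard_diff n N t). lra.
Qed.

Lemma wt_locally_bounded t u : Rabs (u - t) < 1 -> wt u <= exp (2 * K * (Rabs (t - a) + 1)).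
Proof.
intros H.
assert (Hu : Rabs (u - a) <= Rabs (t - a) + 1).
{ replace (u - a) with ((u - t) + (t - a)) by ring.
  eapply Rle_trans; [apply Rabs_triang|]; lra. }
unfold wt.
destruct (Rle_lt_or_eq_dec _ _ Hu) as [H1| ->]; [|lra].
left; apply exp_increasing; nra.
Qed.

Theorem cauchy_lipschitz :
  exists Y : R -> V, Y a = v0 /\ forall t, is_derive Y t (F t (Y t)).
Proof.
destruct picard_limit as [Y HY].
assert (HC : 0 <= C0) by apply Rmax_l.
assert (HYc : forall t, continuous Y t).
{ intros t; apply filterlim_locally; intros e.
  set (M := exp (2 * K * (Rabs (t - a) + 1))).
  (* Two of the three shares pay for replacing [Y] by [picard n] at [u] and at [t]; the rest of [e]
     is the tolerance left for the continuity of [picard n]. *)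
  destruct (half_pow_small (3 * (2 * C0 * M)) e (cond_pos e)) as [n Hn].
  assert (Hpos : 0 < e - 2 * (2 * C0 * M) * (/ 2) ^ n).
  { assert (0 < (/ 2) ^ n) by (apply pow_lt; lra).
    assert (0 < M) by apply exp_pos.
    assert (0 <= C0 * M * (/ 2) ^ n) by (apply Rmult_le_pos; [apply Rmult_le_pos|]; lra).
    lra. }
  pose proof (@norm_factor_gt_0 _ V) as Hnf.
  assert (He' : 0 < (e - 2 * (2 * C0 * M) * (/ 2) ^ n) / @norm_factor _ V)
    by (apply Rdiv_lt_0_compat; auto).
  pose proof (proj1 (filterlim_locally _ _) (picard_continuous n t) (mkposreal _ He')) as Hl.
  assert (H1 : locally t (fun u => Rabs (u - t) < 1)) by (exists (mkposreal 1 Rlt_0_1); auto).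
  generalize (filter_and _ _ Hl H1); apply filter_imp; intros u [Hu Hut].
  apply ball_norm in Hu; simpl in Hu.
  replace (norm_factor * _) with (e - 2 * (2 * C0 * M) * (/ 2) ^ n) in Hu by (field; lra).
  apply norm_ball.
  eapply Rle_lt_trans; [apply (norm_minus_triangle _ (picard n u))|].
  eapply Rle_lt_trans; [apply Rplus_le_compat_l, (norm_minus_triangle _ (picard n t))|].
  rewrite (norm_minus_sym (picard n t)).
  pose proof (HY n t) as HYt; pose proof (HY n u) as HYu.
  pose proof (wt_locally_bounded t u Hut) as Wu.
  assert (Wt : wt t <= M).
  { apply wt_locally_bounded; rewrite Rminus_diag_eq, Rabs_R0; lra. }
  fold M in Wu.
  assert (0 <= 2 * C0 * (/ 2) ^ n).
  { assert (0 < (/ 2) ^ n) by (apply pow_lt; lra); nra. }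
  assert (2 * C0 * (/ 2) ^ n * wt t <= 2 * C0 * (/ 2) ^ n * M) by (apply Rmult_le_compat_l; auto).
  assert (2 * C0 * (/ 2) ^ n * wt u <= 2 * C0 * (/ 2) ^ n * M) by (apply Rmult_le_compat_l; auto).
  lra. }
(* For every [n], both sides lie within a fixed multiple of (1/2)^n of [picard (S n) t]: the left by
   the rate of convergence, the right by the contraction. *)
assert (Hfix : forall t, Y t = plus v0 (RInt (fun u => F u (Y u)) a t)).
{ intros t.
  set (Z := plus v0 _).
  assert (Hz : norm (minus (Y t) Z) <= 0).
  { apply le_epsilon; intros e He.
    destruct (half_pow_small (2 * (2 * C0 * wt t)) e He) as [n Hn].
    eapply Rle_trans; [apply (norm_minus_triangle _ (picard (S n) t))|].
    pose proof (HY (S n) t) as H1.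
    assert (0 < (/ 2) ^ n) by (apply pow_lt; lra).
    pose proof (wt_ge1 t).
    assert (H2 : norm (minus (picard (S n) t) Z) <= 2 * C0 * (/ 2) ^ n / 2 * wt t).
    { apply (integral_eq_contract (picard n) Y).
      - nra.
      - intros; apply picard_continuous.
      - auto.
      - intros u; rewrite norm_minus_sym; apply HY. }
    rewrite <- (tech_pow_Rmult (/ 2) n) in H1.
    assert (0 <= C0 * (/ 2) ^ n * wt t) by (apply Rmult_le_pos; [apply Rmult_le_pos|]; lra).
    lra. }
  pose proof (norm_ge_0 (minus (Y t) Z)).
  assert (H0 : minus (Y t) Z = zero) by (apply (norm_eq_zero (minus (Y t) Z)); lra).
  exact (minus_zero_eq (G := CompleteNormedModule.AbelianGroup R_AbsRing V) _ _ H0). }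
exists Y; split.
- now rewrite Hfix, RInt_point, plus_zero_r.
- intros t.
  apply is_derive_ext with (2 := is_derive_integral_eq Y t HYc).
  intros; now rewrite <- Hfix.
Qed.

End Picard.

(** * Complex linear equations of second order *)

(** The complex equation y'' = (p + i r) y with y = a + i b and y' = a1 + i b1, on the whole
    line. *)
Definition ode_solution (p r a b a1 b1 : R -> R) : Prop :=
  forall z, is_derive a z (a1 z) /\ is_derive b z (b1 z) /\
    is_derive a1 z (p z * a z - r z * b z) /\ is_derive b1 z (r z * a z + p z * b z).

Section ProdComplete.

Context {U V : CompleteNormedModule R_AbsRing}.

Let plim (F : (U * V -> Prop) -> Prop) : U * V :=
  (lim (filtermap fst F), lim (filtermap snd F)).

Lemma prod_complete_cauchy (F : (U * V -> Prop) -> Prop) :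
  ProperFilter F -> cauchy (T := prod_UniformSpace U V) F ->
  forall eps : posreal, F (ball (M := prod_UniformSpace U V) (plim F) eps).
Proof.
intros HF HC e.
assert (H1 : F (fun x => ball (lim (filtermap fst F)) e (fst x))).
{ apply (complete_cauchy (T := U) (filtermap fst F)).
  - apply filtermap_proper_filter; auto.
  - intros d; destruct (HC d) as [x Hx]; exists (fst x); unfold filtermap.
    generalize Hx; apply filter_imp; intros y [Hy _]; exact Hy. }
assert (H2 : F (fun x => ball (lim (filtermap snd F)) e (snd x))).
{ apply (complete_cauchy (T := V) (filtermap snd F)).
  - apply filtermap_proper_filter; auto.
  - intros d; destruct (HC d) as [x Hx]; exists (snd x); unfold filtermap.
    generalize Hx; apply filter_imp; intros y [_ Hy]; exact Hy. }
generalize (filter_and _ _ H1 H2); apply filter_imp; intros y Hy; exact Hy.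
Qed.

Lemma prod_close_lim (F1 F2 : (U * V -> Prop) -> Prop) :
  filter_le F1 F2 -> filter_le F2 F1 ->
  close (M := prod_UniformSpace U V) (plim F1) (plim F2).
Proof.
intros H12 H21 e; split.
- apply (close_lim (T := U)); intros P; [apply H12|apply H21].
- apply (close_lim (T := V)); intros P; [apply H12|apply H21].
Qed.

Definition prod_complete_mixin :=
  CompleteSpace.Mixin (prod_UniformSpace U V) plim prod_complete_cauchy prod_close_lim.

Definition prod_CompleteNormedModule : CompleteNormedModule R_AbsRing :=
  CompleteNormedModule.Pack R_AbsRing (U * V)
    (CompleteNormedModule.Class R_AbsRing (U * V)
      (NormedModule.class R_AbsRing (prod_NormedModule R_AbsRing U V)) prod_complete_mixin)
    (U * V).

End ProdComplete.

Definition R2 := @prod_CompleteNormedModule R_CompleteNormedModule R_CompleteNormedModule.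
Definition R4 := @prod_CompleteNormedModule R2 R2.

(** The first pair of the state is y, the second y', each as real and imaginary part. *)
Definition ode_field (p r : R -> R) (t : R) (v : R4) : R4 :=
  ((fst (snd v), snd (snd v)),
   (p t * fst (fst v) - r t * snd (fst v), r t * fst (fst v) + p t * snd (fst v))).

Lemma norm_R4 (x1 x2 x3 x4 : R) :
  norm (((x1, x2), (x3, x4)) : R4) = sqrt (x1 ^ 2 + x2 ^ 2 + (x3 ^ 2 + x4 ^ 2)).
Proof.
change (sqrt (sqrt (Rabs x1 ^ 2 + Rabs x2 ^ 2) ^ 2 + sqrt (Rabs x3 ^ 2 + Rabs x4 ^ 2) ^ 2)
  = sqrt (x1 ^ 2 + x2 ^ 2 + (x3 ^ 2 + x4 ^ 2))).
rewrite !pow2_abs, !pow2_sqrt; auto; apply Rplus_le_le_0_compat; apply pow2_ge_0.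
Qed.

(** The field is linear, so only its value at the difference matters. Multiplication by p + i r
    scales squared lengths by p^2 + r^2 <= 2 K^2, and the block sending y' to itself is absorbed by
    1 <= K. *)
Lemma ode_field_lip (p r : R -> R) (K t : R) (v w : R4) :
  1 <= K -> Rabs (p t) <= K -> Rabs (r t) <= K ->
  norm (minus (ode_field p r t v) (ode_field p r t w)) <= (2 * K) * norm (minus v w).
Proof.
destruct v as [[v1 v2] [v3 v4]], w as [[w1 w2] [w3 w4]]; intros HK Hp Hr.
apply Rle_trans with (norm (ode_field p r t (((v1 - w1, v2 - w2), (v3 - w3, v4 - w4)) : R4))).
- right; apply f_equal; unfold ode_field; simpl.
  apply injective_projections; apply injective_projections; simpl;
  unfold minus, plus, opp; simpl; unfold plus, opp; simpl; ring.
- change (norm (minus ((v1, v2, (v3, v4)) : R4) ((w1, w2, (w3, w4)) : R4)))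
    with (norm (((v1 - w1, v2 - w2), (v3 - w3, v4 - w4)) : R4)).
  unfold ode_field; cbn [fst snd]; rewrite !norm_R4.
  rewrite <- (sqrt_pow2 (2 * K)) by lra.
  rewrite <- sqrt_mult_alt by apply pow2_ge_0.
  apply sqrt_le_1_alt.
  generalize (v1 - w1) (v2 - w2) (v3 - w3) (v4 - w4); intros x1 x2 x3 x4.
  apply Rabs_le_between in Hp; apply Rabs_le_between in Hr.
  assert (p t ^ 2 <= K ^ 2) by nra.
  assert (r t ^ 2 <= K ^ 2) by nra.
  replace ((p t * x1 - r t * x2) ^ 2 + (r t * x1 + p t * x2) ^ 2)
    with ((p t ^ 2 + r t ^ 2) * (x1 ^ 2 + x2 ^ 2)) by ring.
  pose proof (pow2_ge_0 x1); pose proof (pow2_ge_0 x2).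
  pose proof (pow2_ge_0 x3); pose proof (pow2_ge_0 x4).
  assert (1 <= K ^ 2) by nra.
  nra.
Qed.

Lemma is_derive_fst {U W : NormedModule R_AbsRing} (f : R -> U * W) t l :
  is_derive f t l -> is_derive (fun t => fst (f t)) t (fst l).
Proof.
intros H.
unfold is_derive in *.
eapply filterdiff_ext_lin.
- apply (filterdiff_comp' f fst t (fun y => scal y l) fst H).
  apply filterdiff_linear, is_linear_fst.
- reflexivity.
Qed.

Lemma is_derive_snd {U W : NormedModule R_AbsRing} (f : R -> U * W) t l :
  is_derive f t l -> is_derive (fun t => snd (f t)) t (snd l).
Proof.
intros H.
unfold is_derive in *.
eapply filterdiff_ext_lin.
- apply (filterdiff_comp' f snd t (fun y => scal y l) snd H).
  apply filterdiff_linear, is_linear_snd.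
- reflexivity.
Qed.

Lemma continuous_pair {U W : UniformSpace} (f : R -> U) (g : R -> W) t :
  continuous f t -> continuous g t -> continuous (fun t => (f t, g t)) t.
Proof.
intros Hf Hg; apply filterlim_locally; intros e.
generalize (filter_and _ _ (proj1 (filterlim_locally _ _) Hf e)
  (proj1 (filterlim_locally _ _) Hg e)).
apply filter_imp; intros u [H1 H2]; now split.
Qed.

Lemma ode_exists (p r : R -> R) (K : R) :
  (forall t, continuous p t) -> (forall t, continuous r t) ->
  (forall t, Rabs (p t) <= K) -> (forall t, Rabs (r t) <= K) ->
  exists a b a1 b1 : R -> R, ode_solution p r a b a1 b1 /\
    a (-1) = 0 /\ b (-1) = 0 /\ a1 (-1) = 1 /\ b1 (-1) = 0.
Proof.
intros Hp Hr Hpb Hrb.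
set (L := Rmax 1 K).
assert (1 <= L) by apply Rmax_l; assert (K <= L) by apply Rmax_r.
(* At the initial state y = 0, y' = 1 the field has norm 1 whatever [p] and [r] are, hence the last
   argument. *)
destruct (@cauchy_lipschitz R4 (ode_field p r) (-1) (((0, 0), (1, 0)) : R4) (2 * L) 1)
  as [Y [HY0 HY]].
- lra.
- intros t v w; apply ode_field_lip; auto; apply Rle_trans with K; auto.
- intros Y HY t.
  assert (H1 : continuous (fun u => fst (Y u)) t)
    by (apply (continuous_comp Y fst); [auto|apply continuous_fst]).
  assert (H2 : continuous (fun u => snd (Y u)) t)
    by (apply (continuous_comp Y snd); [auto|apply continuous_snd]).
  assert (H11 : continuous (fun u => fst (fst (Y u))) t)
    by (apply (continuous_comp (fun u => fst (Y u)) fst); [auto|apply continuous_fst]).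
  assert (H12 : continuous (fun u => snd (fst (Y u))) t)
    by (apply (continuous_comp (fun u => fst (Y u)) snd); [auto|apply continuous_snd]).
  assert (H21 : continuous (fun u => fst (snd (Y u))) t)
    by (apply (continuous_comp (fun u => snd (Y u)) fst); [auto|apply continuous_fst]).
  assert (H22 : continuous (fun u => snd (snd (Y u))) t)
    by (apply (continuous_comp (fun u => snd (Y u)) snd); [auto|apply continuous_snd]).
  apply (continuous_pair (U := R2) (W := R2));
  apply (continuous_pair (U := R_UniformSpace) (W := R_UniformSpace)); auto.
  + apply (continuous_minus (V := R_NormedModule)); apply (continuous_mult (K := R_AbsRing)); auto.
  + apply (continuous_plus (V := R_NormedModule)); apply (continuous_mult (K := R_AbsRing)); auto.
- intros t; unfold ode_field; cbn [fst snd]; rewrite norm_R4.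
  replace (_ + _) with 1 by ring; rewrite sqrt_1; lra.
- exists (fun t => fst (fst (Y t))), (fun t => snd (fst (Y t))),
    (fun t => fst (snd (Y t))), (fun t => snd (snd (Y t))).
  rewrite HY0; split; [|now simpl].
  intros z; specialize (HY z).
  pose proof (is_derive_fst (U := R2) (W := R2) _ _ _ HY) as H1.
  pose proof (is_derive_snd (U := R2) (W := R2) _ _ _ HY) as H2.
  refine (conj _ (conj _ (conj _ _))).
  + exact (is_derive_fst (U := R_NormedModule) (W := R_NormedModule) _ _ _ H1).
  + exact (is_derive_snd (U := R_NormedModule) (W := R_NormedModule) _ _ _ H1).
  + exact (is_derive_fst (U := R_NormedModule) (W := R_NormedModule) _ _ _ H2).
  + exact (is_derive_snd (U := R_NormedModule) (W := R_NormedModule) _ _ _ H2).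
Qed.

(** * Stability and symmetry of the shooting solution *)

Definition shooting (p r a b a1 b1 : R -> R) : Prop :=
  ode_solution p r a b a1 b1 /\ a (-1) = 0 /\ b (-1) = 0 /\ a1 (-1) = 1 /\ b1 (-1) = 0.

Lemma derive_le_increasing (f df : R -> R) (x y : R) :
  x <= y -> (forall z, x <= z <= y -> is_derive f z (df z)) ->
  (forall z, x <= z <= y -> 0 <= df z) -> f x <= f y.
Proof.
intros Hxy Hd Hp.
destruct (MVT_gen f x y df) as [c [Hc H]].
- rewrite Rmin_left, Rmax_right by auto; intros; apply Hd; lra.
- rewrite Rmin_left, Rmax_right by auto; intros z Hz.
  apply continuity_pt_filterlim, (ex_derive_continuous (V := R_NormedModule)).
  eexists; now apply Hd.
- rewrite Rmin_left, Rmax_right in Hc by auto.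
  specialize (Hp c Hc); nra.
Qed.

Lemma is_derive_zero_const (f : R -> R) (x y : R) :
  x <= y -> (forall z, x <= z <= y -> is_derive f z 0) -> f x = f y.
Proof.
intros Hxy Hd; apply Rle_antisym.
- apply (derive_le_increasing f (fun _ => 0)); intros; auto; lra.
- apply Ropp_le_cancel, (derive_le_increasing (fun z => - f z) (fun _ => 0)); intros; try lra.
  replace 0 with (- 0) by ring.
  apply (is_derive_opp (V := R_NormedModule)); auto.
Qed.

(** The function (f + c / L) exp (- L z) is nonincreasing; the shift by c / L absorbs the
    forcing. *)
Lemma gronwall (f df : R -> R) (L c x y : R) :
  0 < L -> x <= y ->
  (forall z, x <= z <= y -> is_derive f z (df z)) ->
  (forall z, x <= z <= y -> df z <= L * f z + c) ->
  f y + c / L <= (f x + c / L) * exp (L * (y - x)).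
Proof.
intros HL Hxy Hd Hle.
assert (H : - ((f x + c / L) * exp (- L * x)) <= - ((f y + c / L) * exp (- L * y))).
{ apply (derive_le_increasing (fun z => - ((f z + c / L) * exp (- L * z)))
    (fun z => (L * f z + c - df z) * exp (- L * z))); auto.
  - intros z Hz; specialize (Hd z Hz).
    assert (ex_derive f z) by (eexists; eauto).
    auto_derive; auto.
    rewrite (is_derive_unique (fun x : R => f x) _ _ Hd); field; lra.
  - intros z Hz; specialize (Hle z Hz); apply Rmult_le_pos; [lra|].
    left; apply exp_pos. }
replace (L * (y - x)) with (- L * x + - (- L * y)) by ring.
rewrite exp_plus, exp_Ropp.
pose proof (exp_pos (- L * y)).
apply Rmult_le_reg_r with (exp (- L * y)); auto.
replace (_ * _ * exp (- L * y)) with ((f x + c / L) * exp (- L * x)) by (field; lra).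
lra.
Qed.

Lemma Rabs_mult_le x y a b : Rabs x <= a -> Rabs y <= b -> Rabs (x * y) <= a * b.
Proof. intros; rewrite Rabs_mult; apply Rmult_le_compat; auto using Rabs_pos. Qed.

Lemma Rabs_plus_le x y a b : Rabs x <= a -> Rabs y <= b -> Rabs (x + y) <= a + b.
Proof. intros; eapply Rle_trans; [apply Rabs_triang|lra]. Qed.

Lemma Rabs_minus_le x y a b : Rabs x <= a -> Rabs y <= b -> Rabs (x - y) <= a + b.
Proof. intros; unfold Rminus; apply Rabs_plus_le; auto; now rewrite Rabs_Ropp. Qed.

Lemma double_prod_le (K k x y : R) : Rabs k <= K -> 2 * (x * (k * y)) <= K * (x ^ 2 + y ^ 2).
Proof.
intros H; apply Rabs_le_between in H.
pose proof (pow2_ge_0 (x + y)); pose proof (pow2_ge_0 (x - y)).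
nra.
Qed.

(** The left side is the derivative of |y|^2 + |y'|^2 when y'' = (p + i r) y + g with g = g1 + i g2.
    Taking g = 0 bounds one solution; a nonzero g arises when two solutions are subtracted. *)
Lemma ode_energy (p r : R -> R) (K : R) (a b a1 b1 g1 g2 : R) z :
  Rabs (p z) <= K -> Rabs (r z) <= K ->
  2 * (a * a1 + b * b1 + a1 * (p z * a - r z * b + g1) + b1 * (r z * a + p z * b + g2))
   <= (2 * K + 2) * (a ^ 2 + b ^ 2 + a1 ^ 2 + b1 ^ 2) + (g1 ^ 2 + g2 ^ 2).
Proof.
intros Hp Hr.
pose proof (double_prod_le K (p z) a1 a Hp); pose proof (double_prod_le K (p z) b1 b Hp).
pose proof (double_prod_le K (r z) b1 a Hr).
assert (Hr' : Rabs (- r z) <= K) by now rewrite Rabs_Ropp.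
pose proof (double_prod_le K (- r z) a1 b Hr').
assert (0 <= K) by (eapply Rle_trans; [apply Rabs_pos|eauto]).
pose proof (pow2_ge_0 (a - a1)); pose proof (pow2_ge_0 (b - b1)).
pose proof (pow2_ge_0 (a1 - g1)); pose proof (pow2_ge_0 (b1 - g2)).
pose proof (pow2_ge_0 a); pose proof (pow2_ge_0 b).
nra.
Qed.

Lemma is_derive_sum_sqr (a b c d : R -> R) z a' b' c' d' :
  is_derive a z a' -> is_derive b z b' -> is_derive c z c' -> is_derive d z d' ->
  is_derive (fun z => a z ^ 2 + b z ^ 2 + c z ^ 2 + d z ^ 2) z
    (2 * (a z * a' + b z * b' + c z * c' + d z * d')).
Proof.
intros Ha Hb Hc Hd.
assert (ex_derive a z) by (eexists; eauto).
assert (ex_derive b z) by (eexists; eauto).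
assert (ex_derive c z) by (eexists; eauto).
assert (ex_derive d z) by (eexists; eauto).
auto_derive; auto.
rewrite (is_derive_unique (fun x : R => a x) _ _ Ha), (is_derive_unique (fun x : R => b x) _ _ Hb),
  (is_derive_unique (fun x : R => c x) _ _ Hc), (is_derive_unique (fun x : R => d x) _ _ Hd); ring.
Qed.

Lemma shooting_bound (p r a b a1 b1 : R -> R) (K z : R) :
  (forall z, -1 <= z <= 1 -> Rabs (p z) <= K /\ Rabs (r z) <= K) ->
  shooting p r a b a1 b1 -> -1 <= z <= 1 ->
  a z ^ 2 + b z ^ 2 <= exp (2 * (2 * K + 2)).
Proof.
intros HK [Hs [Ha0 [Hb0 [Ha1 Hb1]]]] Hz.
assert (HK0 : 0 <= K).
{ destruct (HK 0) as [H _]; [lra|]; eapply Rle_trans; [apply Rabs_pos|eauto]. }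
assert (H : a z ^ 2 + b z ^ 2 + a1 z ^ 2 + b1 z ^ 2 + 0 / (2 * K + 2) <=
  (a (-1) ^ 2 + b (-1) ^ 2 + a1 (-1) ^ 2 + b1 (-1) ^ 2 + 0 / (2 * K + 2))
    * exp ((2 * K + 2) * (z - -1))).
{ apply (gronwall (fun z => a z ^ 2 + b z ^ 2 + a1 z ^ 2 + b1 z ^ 2)
   (fun z => 2 * (a z * a1 z + b z * b1 z + a1 z * (p z * a z - r z * b z)
     + b1 z * (r z * a z + p z * b z)))); try lra.
  - intros t _; destruct (Hs t) as [H1 [H2 [H3 H4]]]; now apply is_derive_sum_sqr.
  - intros t Ht; destruct (HK t) as [Hp Hr]; [lra|].
    pose proof (ode_energy p r K (a t) (b t) (a1 t) (b1 t) 0 0 t Hp Hr); lra. }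
rewrite Ha0, Hb0, Ha1, Hb1 in H.
replace (0 / (2 * K + 2)) with 0 in H by (field; lra).
assert (exp ((2 * K + 2) * (z - -1)) <= exp (2 * (2 * K + 2))).
{ destruct (Req_dec z 1) as [->|Hz1]; [right; f_equal; ring|].
  left; apply exp_increasing; nra. }
pose proof (pow2_ge_0 (a1 z)); pose proof (pow2_ge_0 (b1 z)); lra.
Qed.

(** The difference of the solutions has zero data at -1 and solves the equation with coefficients
    [p], [r] and forcing ((p - p0) + i (r - r0)) y0, where y0 is controlled by [shooting_bound]. *)
Lemma shooting_stable (K delta : R) (p r a b a1 b1 p0 r0 a0 b0 a01 b01 : R -> R) :
  (forall z, -1 <= z <= 1 -> Rabs (p z) <= K /\ Rabs (r z) <= K) ->
  (forall z, -1 <= z <= 1 -> Rabs (p0 z) <= K /\ Rabs (r0 z) <= K) ->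
  (forall z, -1 <= z <= 1 -> Rabs (p z - p0 z) <= delta /\ Rabs (r z - r0 z) <= delta) ->
  shooting p r a b a1 b1 -> shooting p0 r0 a0 b0 a01 b01 ->
  Rabs (a 1 - a0 1) <= 3 * exp (2 * (2 * K + 2)) * delta.
Proof.
intros HK HK0 Hdel Hsh Hsh0.
assert (HKpos : 0 <= K).
{ destruct (HK 0) as [H _]; [lra|]; eapply Rle_trans; [apply Rabs_pos|eauto]. }
assert (Hdpos : 0 <= delta).
{ destruct (Hdel 0) as [H _]; [lra|]; eapply Rle_trans; [apply Rabs_pos|eauto]. }
set (L := 2 * K + 2) in *; set (e := exp (2 * L)).
assert (He : 0 < e) by apply exp_pos.
assert (HL : 2 <= L) by (unfold L; lra).
(* The squared forcing is at most 2 e delta^2. The coefficient 8 still yields 8 e^2 delta^2 <= (3 e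
   delta)^2 at the end. *)
set (c := 8 * e * delta ^ 2).
assert (Hb := fun z => shooting_bound p0 r0 a0 b0 a01 b01 K z HK0 Hsh0).
destruct Hsh as [Hs [Ha0 [Hb0 [Ha1 Hb1]]]], Hsh0 as [Hs0 [Ha00 [Hb00 [Ha01 Hb01]]]].
pose proof (gronwall
  (fun z => (a z - a0 z) ^ 2 + (b z - b0 z) ^ 2 + (a1 z - a01 z) ^ 2 + (b1 z - b01 z) ^ 2)
  (fun z => 2 * ((a z - a0 z) * (a1 z - a01 z) + (b z - b0 z) * (b1 z - b01 z)
    + (a1 z - a01 z) * (p z * (a z - a0 z) - r z * (b z - b0 z)
        + ((p z - p0 z) * a0 z - (r z - r0 z) * b0 z))
    + (b1 z - b01 z) * (r z * (a z - a0 z) + p z * (b z - b0 z)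
        + ((r z - r0 z) * a0 z + (p z - p0 z) * b0 z)))) L c (-1) 1) as H.
cbv beta in H.
rewrite Ha0, Hb0, Ha1, Hb1, Ha00, Hb00, Ha01, Hb01 in H.
assert (HE : (a 1 - a0 1) ^ 2 + (b 1 - b0 1) ^ 2 + (a1 1 - a01 1) ^ 2 + (b1 1 - b01 1) ^ 2 + c / L
   <= c / L * e).
{ replace (c / L * e) with (((0 - 0) ^ 2 + (0 - 0) ^ 2 + (1 - 1) ^ 2 + (0 - 0) ^ 2 + c / L)
    * exp (L * (1 - -1))).
  2:{ unfold e; replace (L * (1 - -1)) with (2 * L) by ring; ring. }
  apply H; try lra.
  - intros z _; destruct (Hs z) as [H1 [H2 [H3 H4]]], (Hs0 z) as [H5 [H6 [H7 H8]]].
    apply (is_derive_sum_sqr (fun z => a z - a0 z) (fun z => b z - b0 z)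
      (fun z => a1 z - a01 z) (fun z => b1 z - b01 z)).
    + now apply (is_derive_minus (V := R_NormedModule)).
    + now apply (is_derive_minus (V := R_NormedModule)).
    + replace (_ + _) with ((p z * a z - r z * b z) - (p0 z * a0 z - r0 z * b0 z)) by ring.
      now apply (is_derive_minus (V := R_NormedModule)).
    + replace (_ + _) with ((r z * a z + p z * b z) - (r0 z * a0 z + p0 z * b0 z)) by ring.
      now apply (is_derive_minus (V := R_NormedModule)).
  - intros z Hz; destruct (HK z Hz) as [Hp Hr], (Hdel z Hz) as [Hdp Hdr].
    eapply Rle_trans; [apply (ode_energy p r K); auto|].
    fold L; apply Rplus_le_compat_l.
    specialize (Hb z Hz); fold L in Hb; fold e in Hb.
    replace (_ + _) with (((p z - p0 z) ^ 2 + (r z - r0 z) ^ 2) * (a0 z ^ 2 + b0 z ^ 2)) by ring.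
    assert ((p z - p0 z) ^ 2 <= delta ^ 2) by (apply pow_maj_Rabs; auto).
    assert ((r z - r0 z) ^ 2 <= delta ^ 2) by (apply pow_maj_Rabs; auto).
    pose proof (pow2_ge_0 (a0 z)); pose proof (pow2_ge_0 (b0 z)); pose proof (pow2_ge_0 delta).
    pose proof (pow2_ge_0 (p z - p0 z)); pose proof (pow2_ge_0 (r z - r0 z)).
    unfold c; apply Rle_trans with ((2 * delta ^ 2) * e); [apply Rmult_le_compat; lra|].
    assert (0 <= e * delta ^ 2) by (apply Rmult_le_pos; lra); lra. }
assert (Hc : 0 <= c) by (unfold c; pose proof (pow2_ge_0 delta); nra).
assert (Hcl : c / L <= c) by (apply Rle_div_l; nra).
assert (0 <= c / L) by (apply Rdiv_le_0_compat; lra).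
assert (Hsq : (a 1 - a0 1) ^ 2 <= (3 * e * delta) ^ 2).
{ pose proof (pow2_ge_0 (b 1 - b0 1)); pose proof (pow2_ge_0 (a1 1 - a01 1)).
  pose proof (pow2_ge_0 (b1 1 - b01 1)).
  apply Rle_trans with (c * e); [nra|].
  unfold c; pose proof (pow2_ge_0 (e * delta)); nra. }
rewrite <- (Rabs_pos_eq (3 * e * delta)) by (apply Rmult_le_pos; lra).
apply Rsqr_le_abs_0; unfold Rsqr; lra.
Qed.

(* [W(z) = y(z) (conj y(-z))' - y'(z) conj y(-z)] is constant, and the boundary data
   give [Im W(1) = - Im y(1)] and [Im W(-1) = Im y(1)]. *)
Lemma shooting_end_real (p r a b a1 b1 : R -> R) :
  (forall z, p (- z) = p z) -> (forall z, r (- z) = - r z) ->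
  shooting p r a b a1 b1 -> b 1 = 0.
Proof.
intros Hp Hr [Hs [Ha0 [Hb0 [Ha1 Hb1]]]].
set (W := fun z => a z * b1 (- z) - b z * a1 (- z) + a1 z * b (- z) - b1 z * a (- z)).
assert (HW : forall z, is_derive W z 0).
{ intros z; destruct (Hs z) as [H1 [H2 [H3 H4]]], (Hs (- z)) as [H5 [H6 [H7 H8]]].
  assert (ex_derive a z) by (eexists; eauto).
  assert (ex_derive b z) by (eexists; eauto).
  assert (ex_derive a1 z) by (eexists; eauto).
  assert (ex_derive b1 z) by (eexists; eauto).
  assert (ex_derive a (- z)) by (eexists; eauto).
  assert (ex_derive b (- z)) by (eexists; eauto).
  assert (ex_derive a1 (- z)) by (eexists; eauto).
  assert (ex_derive b1 (- z)) by (eexists; eauto).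
  unfold W; auto_derive; [tauto|].
  rewrite (is_derive_unique (fun x : R => a x) _ _ H1), (is_derive_unique (fun x : R => b x) _ _ H2),
    (is_derive_unique (fun x : R => a1 x) _ _ H3), (is_derive_unique (fun x : R => b1 x) _ _ H4),
    (is_derive_unique (fun x : R => a x) _ _ H5), (is_derive_unique (fun x : R => b x) _ _ H6),
    (is_derive_unique (fun x : R => a1 x) _ _ H7), (is_derive_unique (fun x : R => b1 x) _ _ H8), Hp, Hr; ring. }
assert (HWe : W (-1) = W 1)
  by (apply is_derive_zero_const; auto; lra).
unfold W in HWe.
replace (Ropp (-1)) with 1 in HWe by ring.
replace (Ropp 1) with (-1) in HWe by ring.
rewrite Ha0, Hb0, Ha1, Hb1 in HWe; lra.
Qed.

(** * The shear profile *)

Definition wz (z : R) : R := z ^ 2 + 3 / 2.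
Definition U (z : R) : R := z / wz z.
Definition U' (z : R) : R := (3 / 2 - z ^ 2) / wz z ^ 2.
Definition U'' (z : R) : R := (2 * z ^ 3 - 9 * z) / wz z ^ 3.

(* [1 / (U - i s) = ReX s + i ImX s] *)
Definition ReX (s z : R) : R := U z / (U z ^ 2 + s ^ 2).
Definition ImX (s z : R) : R := s / (U z ^ 2 + s ^ 2).

(* Real and imaginary parts of [alpha^2 + U''/(U - i s) - eps/(U - i s)^2]. *)
Definition tg_re (alpha eps s z : R) : R :=
  alpha ^ 2 + U'' z * ReX s z - eps * (ReX s z ^ 2 - ImX s z ^ 2).
Definition tg_im (eps s z : R) : R := U'' z * ImX s z - eps * (2 * ReX s z * ImX s z).

Lemma wz_ge z : 3 / 2 <= wz z.
Proof. unfold wz; pose proof (pow2_ge_0 z); lra. Qed.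

Lemma wz_pos z : 0 < wz z.
Proof. pose proof (wz_ge z); lra. Qed.

Lemma chi_pos s z : 0 < s -> 0 < U z ^ 2 + s ^ 2.
Proof. intros; pose proof (pow2_ge_0 (U z)); pose proof (pow_lt s 2 H); lra. Qed.

Lemma is_derive_U z : is_derive U z (U' z).
Proof.
pose proof (wz_pos z) as H; unfold U, U', wz in *.
auto_derive; [lra|]; field; lra.
Qed.

Lemma is_derive_U' z : is_derive U' z (U'' z).
Proof.
pose proof (wz_pos z) as H; unfold U', U'', wz in *.
auto_derive; [repeat split; auto; nra|]; field; lra.
Qed.

Lemma U_bound z : Rabs (U z) <= 1.
Proof.
pose proof (wz_pos z); unfold U.
rewrite Rabs_div, (Rabs_pos_eq (wz z)) by lra.
apply Rle_div_l; auto; rewrite Rmult_1_l; unfold wz.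
apply Rabs_le; split; nra.
Qed.

Lemma U''_bound z : Rabs (U'' z) <= 6.
Proof.
pose proof (wz_ge z).
(* The constant comes from |2 z^2 - 9| <= 6 z^2 + 9 = 6 w <= 6 w^2 with w = [wz z]. *)
replace (U'' z) with (U z * ((2 * z ^ 2 - 9) / wz z ^ 2)) by (unfold U'', U; field; lra).
replace 6 with (1 * 6) by ring; apply Rabs_mult_le; [apply U_bound|].
rewrite Rabs_div by (apply pow_nonzero; lra).
rewrite (Rabs_pos_eq (wz z ^ 2)) by (apply pow_le; lra).
apply Rle_div_l; [apply pow_lt; lra|].
apply Rle_trans with (6 * wz z); [apply Rabs_le; unfold wz; split; nra|nra].
Qed.

Lemma ReX_ImX_bound sigma s z : 0 < sigma -> sigma <= s ->
  Rabs (ReX s z) <= / sigma /\ Rabs (ImX s z) <= / sigma.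
Proof.
intros H1 H2.
assert (Hs : 0 < s) by lra; pose proof (chi_pos s z Hs) as Hp.
assert (HX : ReX s z ^ 2 + ImX s z ^ 2 <= (/ sigma) ^ 2).
{ replace (ReX s z ^ 2 + ImX s z ^ 2) with (/ (U z ^ 2 + s ^ 2)) by (unfold ReX, ImX; field; lra).
  rewrite pow_inv; apply Rinv_le_contravar; [apply pow_lt; auto|].
  pose proof (pow2_ge_0 (U z)); nra. }
pose proof (Rinv_0_lt_compat sigma H1).
pose proof (pow2_ge_0 (ReX s z)); pose proof (pow2_ge_0 (ImX s z)).
split; rewrite <- (Rabs_pos_eq (/ sigma)) by lra; apply Rsqr_le_abs_0; unfold Rsqr; nra.
Qed.

Lemma tg_bound sigma alpha eps s z :
  0 < sigma -> sigma <= s -> Rabs alpha <= 1 -> Rabs eps <= 1 ->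
  Rabs (tg_re alpha eps s z) <= 1 + 6 * / sigma + 2 * (/ sigma) ^ 2 /\
  Rabs (tg_im eps s z) <= 1 + 6 * / sigma + 2 * (/ sigma) ^ 2.
Proof.
intros H1 H2 Ha He.
destruct (ReX_ImX_bound sigma s z H1 H2) as [HA HB].
pose proof (U''_bound z) as HU.
assert (0 <= / sigma) by (left; now apply Rinv_0_lt_compat).
split.
- unfold tg_re.
  replace (1 + 6 * / sigma + 2 * (/ sigma) ^ 2)
    with ((1 * 1 + 6 * / sigma) + 1 * (/ sigma * / sigma + / sigma * / sigma)) by ring.
  replace (alpha ^ 2) with (alpha * alpha) by ring.
  replace (ReX s z ^ 2) with (ReX s z * ReX s z) by ring.
  replace (ImX s z ^ 2) with (ImX s z * ImX s z) by ring.
  auto using Rabs_mult_le, Rabs_minus_le, Rabs_plus_le.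
- unfold tg_im.
  apply Rle_trans with (6 * / sigma + 1 * (2 * / sigma * / sigma)); [|nra].
  assert (Rabs 2 <= 2) by (rewrite Rabs_pos_eq; lra).
  auto 10 using Rabs_mult_le, Rabs_minus_le, Rabs_plus_le.
Qed.

Lemma tg_perturb sigma alpha eps s z : 0 < sigma -> sigma <= s -> 0 <= eps ->
  Rabs (tg_re alpha eps s z - tg_re 0 0 s z) <= alpha ^ 2 + 2 * eps * (/ sigma) ^ 2 /\
  Rabs (tg_im eps s z - tg_im 0 s z) <= alpha ^ 2 + 2 * eps * (/ sigma) ^ 2.
Proof.
intros H1 H2 He.
destruct (ReX_ImX_bound sigma s z H1 H2) as [HA HB].
assert (Rabs eps <= eps) by (rewrite Rabs_pos_eq; lra).
split.
- unfold tg_re.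
  replace (_ - _) with (alpha ^ 2 - eps * (ReX s z * ReX s z - ImX s z * ImX s z)) by ring.
  replace (2 * eps * (/ sigma) ^ 2)
    with (eps * (/ sigma * / sigma + / sigma * / sigma)) by ring.
  assert (Rabs (alpha ^ 2) <= alpha ^ 2)
    by (rewrite Rabs_pos_eq; [lra|apply pow2_ge_0]).
  auto using Rabs_mult_le, Rabs_minus_le, Rabs_plus_le.
- unfold tg_im.
  replace (_ - _) with (- (eps * (2 * ReX s z * ImX s z))) by ring.
  rewrite Rabs_Ropp.
  assert (Rabs 2 <= 2) by (rewrite Rabs_pos_eq; lra).
  apply Rle_trans with (eps * (2 * / sigma * / sigma)).
  + auto using Rabs_mult_le.
  + pose proof (pow2_ge_0 alpha); simpl; lra.
Qed.

(** Resolvent identity: 1/(U - i s) - 1/(U - i t) = i (s - t) / ((U - i s)(U - i t)), whose parts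
    are [EA] and [EB]. With m = 1/sigma >= 1, the total 12 m^2 + 8 m^3 is at most 20 m^3. *)
Lemma tg_lipschitz sigma alpha eps s t z :
  0 < sigma <= 1 -> sigma <= s -> sigma <= t -> Rabs eps <= 1 ->
  Rabs (tg_re alpha eps s z - tg_re alpha eps t z) <= 20 * (/ sigma) ^ 3 * Rabs (s - t) /\
  Rabs (tg_im eps s z - tg_im eps t z) <= 20 * (/ sigma) ^ 3 * Rabs (s - t).
Proof.
intros [H1 H1'] Hs Ht He.
destruct (ReX_ImX_bound sigma s z H1 Hs) as [HA HB].
destruct (ReX_ImX_bound sigma t z H1 Ht) as [HA' HB'].
pose proof (U''_bound z) as HU.
assert (Hsp : 0 < s) by lra; assert (Htp : 0 < t) by lra.
pose proof (chi_pos s z Hsp); pose proof (chi_pos t z Htp).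
assert (EA : ReX s z - ReX t z = - ((s - t) * (ReX s z * ImX t z + ImX s z * ReX t z)))
  by (unfold ReX, ImX; field; lra).
assert (EB : ImX s z - ImX t z = (s - t) * (ReX s z * ReX t z - ImX s z * ImX t z))
  by (unfold ReX, ImX; field; lra).
set (m := / sigma) in *.
assert (Hm : 1 <= m) by (unfold m; rewrite <- Rinv_1; apply Rinv_le_contravar; lra).
assert (DA : Rabs (ReX s z - ReX t z) <= Rabs (s - t) * (m * m + m * m)).
{ rewrite EA, Rabs_Ropp; apply Rabs_mult_le; [lra|].
  auto using Rabs_mult_le, Rabs_plus_le. }
assert (DB : Rabs (ImX s z - ImX t z) <= Rabs (s - t) * (m * m + m * m)).
{ rewrite EB; apply Rabs_mult_le; [lra|].
  auto using Rabs_mult_le, Rabs_minus_le. }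
set (d := Rabs (s - t) * (m * m + m * m)) in *.
assert (Hd0 : 0 <= d) by (eapply Rle_trans; [apply Rabs_pos|eauto]).
assert (Hfin : 6 * d + 4 * m * d <= 20 * m ^ 3 * Rabs (s - t)).
{ unfold d; pose proof (Rabs_pos (s - t)).
  assert (m * m <= m ^ 3) by nra.
  assert (m * m * Rabs (s - t) <= m ^ 3 * Rabs (s - t)) by (apply Rmult_le_compat_r; auto).
  nra. }
split.
- apply Rle_trans with (6 * d + 1 * ((m + m) * d + (m + m) * d)); [|lra].
  replace (_ - _) with (U'' z * (ReX s z - ReX t z)
     - eps * ((ReX s z + ReX t z) * (ReX s z - ReX t z)
              - (ImX s z + ImX t z) * (ImX s z - ImX t z))) by (unfold tg_re; ring).
  auto 10 using Rabs_mult_le, Rabs_minus_le, Rabs_plus_le.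
- apply Rle_trans with (6 * d + 1 * (2 * (d * m + m * d))); [|lra].
  assert (Rabs 2 <= 2) by (rewrite Rabs_pos_eq; lra).
  replace (_ - _) with (U'' z * (ImX s z - ImX t z)
     - eps * (2 * ((ReX s z - ReX t z) * ImX s z + ReX t z * (ImX s z - ImX t z))))
    by (unfold tg_im; ring).
  auto 10 using Rabs_mult_le, Rabs_minus_le, Rabs_plus_le.
Qed.

Lemma is_derive_ReX s z : 0 < s -> is_derive (ReX s) z (- U' z * (ReX s z ^ 2 - ImX s z ^ 2)).
Proof.
intros Hs; pose proof (chi_pos s z Hs) as Hp.
pose proof (is_derive_U z) as HU.
assert (ex_derive U z) by (eexists; eauto).
unfold ReX, ImX; auto_derive; [repeat split; auto; nra|].
rewrite (is_derive_unique (fun x : R => U x) _ _ HU); field; lra.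
Qed.

Lemma is_derive_ImX s z : 0 < s -> is_derive (ImX s) z (- U' z * (2 * ReX s z * ImX s z)).
Proof.
intros Hs; pose proof (chi_pos s z Hs) as Hp.
pose proof (is_derive_U z) as HU.
assert (ex_derive U z) by (eexists; eauto).
unfold ReX, ImX; auto_derive; [repeat split; auto; nra|].
rewrite (is_derive_unique (fun x : R => U x) _ _ HU); field; lra.
Qed.

(** * The neutral limit *)

(* At [alpha = eps = 0] the equation has the solution [chi = U - i s], so
   [y' chi - y U'] is constant; [F] is [Re (conj (chi (-1)) * (y / chi))]. *)
Lemma neutral_primitive s a b a1 b1 :
  0 < s -> shooting (tg_re 0 0 s) (tg_im 0 s) a b a1 b1 ->
  exists F : R -> R, F (-1) = 0 /\ F 1 = - a 1 /\
    forall z, -1 <= z <= 1 ->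
      is_derive F z (((2 / 5) ^ 2 + s ^ 2) * (ReX s z ^ 2 - ImX s z ^ 2)).
Proof.
intros Hs [Hode [Ha0 [Hb0 [Ha1 Hb1]]]].
assert (HUm : U (-1) = - (2 / 5)) by (unfold U, wz; field).
assert (HU1 : U 1 = 2 / 5) by (unfold U, wz; field).
assert (Hchi := fun z => chi_pos s z Hs).
(* Real and imaginary parts of y' chi - y U'. Since y vanishes at -1 with slope 1, their constant
   values are those of chi (-1) = -2/5 - i s. *)
set (wr := fun z => a1 z * U z + b1 z * s - a z * U' z).
set (wi := fun z => b1 z * U z - a1 z * s - b z * U' z).
assert (Hex : forall z, ex_derive a z /\ ex_derive b z /\ ex_derive a1 z /\ ex_derive b1 z
   /\ ex_derive U z /\ ex_derive U' z /\ ex_derive (ReX s) z /\ ex_derive (ImX s) z).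
{ intros z; destruct (Hode z) as [H1 [H2 [H3 H4]]].
  pose proof (is_derive_U z); pose proof (is_derive_U' z).
  pose proof (is_derive_ReX s z Hs); pose proof (is_derive_ImX s z Hs).
  repeat match goal with |- _ /\ _ => split end; eexists; eauto. }
assert (Hwr : forall z, is_derive wr z 0).
{ intros z; destruct (Hode z) as [H1 [H2 [H3 H4]]], (Hex z) as [? [? [? [? [? [? _]]]]]].
  unfold wr; auto_derive; [repeat match goal with |- _ /\ _ => split end; auto|].
  rewrite (is_derive_unique (fun x : R => a x) _ _ H1),
    (is_derive_unique (fun x : R => a1 x) _ _ H3), (is_derive_unique (fun x : R => b1 x) _ _ H4),
    (is_derive_unique (fun x : R => U x) _ _ (is_derive_U z)),
    (is_derive_unique (fun x : R => U' x) _ _ (is_derive_U' z)).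
  specialize (Hchi z); unfold tg_re, tg_im, ReX, ImX; field; lra. }
assert (Hwi : forall z, is_derive wi z 0).
{ intros z; destruct (Hode z) as [H1 [H2 [H3 H4]]], (Hex z) as [? [? [? [? [? [? _]]]]]].
  unfold wi; auto_derive; [repeat match goal with |- _ /\ _ => split end; auto|].
  rewrite (is_derive_unique (fun x : R => b x) _ _ H2),
    (is_derive_unique (fun x : R => a1 x) _ _ H3), (is_derive_unique (fun x : R => b1 x) _ _ H4),
    (is_derive_unique (fun x : R => U x) _ _ (is_derive_U z)),
    (is_derive_unique (fun x : R => U' x) _ _ (is_derive_U' z)).
  specialize (Hchi z); unfold tg_re, tg_im, ReX, ImX; field; lra. }
(* Multiplying by conj (chi (-1)) serves twice: the derivative becomes |chi (-1)|^2 Re (chi^(-2)),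
   and, [U] being odd, conj (chi (-1)) = - chi 1 cancels the denominator of y / chi at 1. *)
exists (fun z => - (2 / 5) * (a z * ReX s z - b z * ImX s z)
                 - s * (a z * ImX s z + b z * ReX s z)).
split; [|split].
- rewrite Ha0, Hb0; ring.
- unfold ReX, ImX; rewrite HU1; field; nra.
- intros z Hz; destruct (Hode z) as [H1 [H2 _]], (Hex z) as [? [? [_ [_ [_ [_ [? ?]]]]]]].
  assert (Er : wr z = - (2 / 5)).
  { rewrite <- (is_derive_zero_const wr (-1) z) by (auto; lra).
    unfold wr; rewrite Ha0, Ha1, Hb1, HUm; ring. }
  assert (Ei : wi z = - s).
  { rewrite <- (is_derive_zero_const wi (-1) z) by (auto; lra).
    unfold wi; rewrite Hb0, Ha1, Hb1; ring. }
  auto_derive; [repeat match goal with |- _ /\ _ => split end; auto|].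
  rewrite (is_derive_unique (fun x : R => a x) _ _ H1),
    (is_derive_unique (fun x : R => b x) _ _ H2),
    (is_derive_unique (fun x : R => ReX s x) _ _ (is_derive_ReX s z Hs)),
    (is_derive_unique (fun x : R => ImX s x) _ _ (is_derive_ImX s z Hs)).
  transitivity (- (2 / 5) * (wr z * (ReX s z ^ 2 - ImX s z ^ 2) - wi z * (2 * ReX s z * ImX s z))
    - s * (wr z * (2 * ReX s z * ImX s z) + wi z * (ReX s z ^ 2 - ImX s z ^ 2))).
  + specialize (Hchi z); unfold wr, wi, ReX, ImX; field; lra.
  + rewrite Er, Ei; ring.
Qed.

(** At s = 1 the integrand has a sign at every point: |U| < 1 gives Re (U - i)^(-2) = (U^2 - 1) /
    (U^2 + 1)^2 < 0. *)
Lemma neutral_end_pos a b a1 b1 :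
  shooting (tg_re 0 0 1) (tg_im 0 1) a b a1 b1 -> 0 < a 1.
Proof.
intros H; destruct (neutral_primitive 1 a b a1 b1 Rlt_0_1 H) as [F [F0 [F1 HF]]].
destruct (MVT_gen F (-1) 1 (fun z => ((2 / 5) ^ 2 + 1 ^ 2) * (ReX 1 z ^ 2 - ImX 1 z ^ 2)))
  as [c [_ Hc]].
- rewrite Rmin_left, Rmax_right by lra; intros; apply HF; lra.
- rewrite Rmin_left, Rmax_right by lra; intros z Hz.
  apply continuity_pt_filterlim, (ex_derive_continuous (V := R_NormedModule)).
  eexists; apply HF; lra.
- rewrite F0, F1 in Hc.
  assert (Hneg : ReX 1 c ^ 2 - ImX 1 c ^ 2 < 0).
  { pose proof (chi_pos 1 c Rlt_0_1).
    replace (_ - _) with (- ((1 - U c ^ 2) / (U c ^ 2 + 1 ^ 2) ^ 2))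
      by (unfold ReX, ImX; field; lra).
    apply Ropp_lt_gt_0_contravar, Rdiv_lt_0_compat; [|apply pow_lt; lra].
    unfold U; pose proof (wz_pos c).
    replace (1 - (c / wz c) ^ 2) with ((wz c ^ 2 - c ^ 2) / wz c ^ 2) by (field; lra).
    apply Rdiv_lt_0_compat; [unfold wz; nra|apply pow_lt; lra]. }
  nra.
Qed.

(** The integrand reaches -1/s^2 at z = 0, so no uniform lower bound is useful. An exact derivative
    carries the singular part; the remainder is 4 w (1 - q)^2 with w = [wz z] and q = x / (z^2 + x).
    Here (1 - q)^2 >= 1 - 2 q, and w <= 5/2 gives the factor 20 = 4 * (5/2) * 2. The scaling s = 2/5
    tau makes x = s^2 w^2 <= tau^2, so that q is dominated by a function with an arctangent
    primitive. *)
Lemma neutral_integrand_lower (tau z : R) : 0 < tau -> -1 <= z <= 1 ->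
  let s := 2 / 5 * tau in
  - (- wz z ^ 2 * z ^ 2 + s ^ 2 * wz z ^ 4 + 4 * z ^ 4 * wz z) / (z ^ 2 + s ^ 2 * wz z ^ 2) ^ 2
    + 4 * wz z - 20 * (tau ^ 2 / (z ^ 2 + tau ^ 2))
  <= ReX s z ^ 2 - ImX s z ^ 2.
Proof.
intros Ht Hz s.
assert (Hs : 0 < s) by (unfold s; lra).
pose proof (wz_pos z) as Hw; pose proof (chi_pos s z Hs) as Hchi.
assert (Hw1 : wz z <= 5 / 2) by (unfold wz; nra).
set (x := s ^ 2 * wz z ^ 2).
assert (Hx : 0 < x) by (unfold x; apply Rmult_lt_0_compat; apply pow_lt; auto).
assert (Hxt : x <= tau ^ 2).
{ unfold x, s; replace ((2 / 5 * tau) ^ 2 * wz z ^ 2) with (tau ^ 2 * (2 / 5 * wz z) ^ 2) by ring.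
  assert ((2 / 5 * wz z) ^ 2 <= 1) by nra.
  pose proof (pow2_ge_0 tau); nra. }
pose proof (pow2_ge_0 z) as Hz2.
assert (E : ReX s z ^ 2 - ImX s z ^ 2
  = - (- wz z ^ 2 * z ^ 2 + s ^ 2 * wz z ^ 4 + 4 * z ^ 4 * wz z) / (z ^ 2 + x) ^ 2
    + 4 * wz z * (z ^ 4 / (z ^ 2 + x) ^ 2)).
{ assert (U z ^ 2 + s ^ 2 = (z ^ 2 + x) / wz z ^ 2) by (unfold U, x; field; lra).
  unfold ReX, ImX; rewrite H; unfold U, x; field; split; [|lra].
  rewrite Rpow_mult_distr; fold x; lra. }
rewrite E.
assert (H1 : 1 - z ^ 4 / (z ^ 2 + x) ^ 2 <= 2 * (x / (z ^ 2 + x))).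
{ apply Rminus_le.
  replace (_ - _) with (- (x / (z ^ 2 + x)) ^ 2) by (field; lra).
  pose proof (pow2_ge_0 (x / (z ^ 2 + x))); lra. }
assert (H2 : x / (z ^ 2 + x) <= tau ^ 2 / (z ^ 2 + tau ^ 2)).
{ pose proof (pow_lt tau 2 Ht).
  apply Rle_div_l; [lra|].
  replace (_ / _ * _) with (tau ^ 2 * (z ^ 2 + x) / (z ^ 2 + tau ^ 2)) by (field; lra).
  assert (Hp : z ^ 2 + tau ^ 2 > 0) by lra.
  apply (proj1 (Rle_div_r x _ _ Hp)); nra. }
assert (0 < x / (z ^ 2 + x)) by (apply Rdiv_lt_0_compat; lra).
nra.
Qed.

Lemma neutral_end_neg a b a1 b1 :
  shooting (tg_re 0 0 (1 / 250)) (tg_im 0 (1 / 250)) a b a1 b1 -> a 1 < 0.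
Proof.
set (s := 1 / 250); assert (Hs : 0 < s) by (unfold s; lra); intros H.
destruct (neutral_primitive s a b a1 b1 Hs H) as [F [F0 [F1 HF]]].
set (tau := 1 / 100).
assert (Est : s = 2 / 5 * tau) by (unfold s, tau; lra).
set (c := (2 / 5) ^ 2 + s ^ 2).
assert (Hc : 0 < c) by (unfold c, s; lra).
(* With [w = wz z], [-(z w^2/(z^2 + s^2 w^2))' = Re (U - i s)^(-2) - 4 z^4 w/(z^2 + s^2 w^2)^2];
   the other two terms of [G] integrate a lower bound of the last fraction. *)
set (G := fun z => - (z * wz z ^ 2 / (z ^ 2 + s ^ 2 * wz z ^ 2))
  + 4 * (z ^ 3 / 3 + 3 / 2 * z) - 20 * (tau * atan (z / tau))).
assert (HG : forall z, is_derive G z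
  (- (- wz z ^ 2 * z ^ 2 + s ^ 2 * wz z ^ 4 + 4 * z ^ 4 * wz z) / (z ^ 2 + s ^ 2 * wz z ^ 2) ^ 2
    + 4 * wz z - 20 * (tau ^ 2 / (z ^ 2 + tau ^ 2)))).
{ intros z; pose proof (wz_pos z) as Hw.
  assert (Hd : 0 < z ^ 2 + s ^ 2 * wz z ^ 2).
  { pose proof (pow2_ge_0 z).
    assert (0 < s ^ 2 * wz z ^ 2) by (apply Rmult_lt_0_compat; apply pow_lt; auto); lra. }
  pose proof (pow2_ge_0 z).
  unfold G, wz in *; auto_derive.
  - apply Rgt_not_eq; simpl in Hd; lra.
  - unfold Rsqr, tau; field; repeat split; try lra. }
assert (Hinc : F (-1) - c * G (-1) <= F 1 - c * G 1).
{ apply (derive_le_increasing (fun z => F z - c * G z)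
    (fun z => c * (ReX s z ^ 2 - ImX s z ^ 2) -
      c * (- (- wz z ^ 2 * z ^ 2 + s ^ 2 * wz z ^ 4 + 4 * z ^ 4 * wz z) / (z ^ 2 + s ^ 2 * wz z ^ 2) ^ 2
    + 4 * wz z - 20 * (tau ^ 2 / (z ^ 2 + tau ^ 2))))); [lra| |].
  - intros z Hz; apply (is_derive_minus (V := R_NormedModule)); [now apply HF|].
    now apply is_derive_scal.
  - intros z Hz.
    assert (Htau : 0 < tau) by (unfold tau; lra).
    pose proof (neutral_integrand_lower tau z Htau Hz) as Hl; cbv zeta in Hl.
    rewrite <- Est in Hl; nra. }
assert (HGodd : G (-1) = - G 1).
{ unfold G, wz; replace (-1 / tau) with (- (1 / tau)) by (unfold tau; field).
  rewrite atan_opp; unfold s; field. }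
(* The first two terms are about -25/4 + 22/3 = 13/12, half the finite part of the integral of
   U^(-2). With tau = 1/100 the arctangent costs less than 2/5. *)
assert (HG1 : 0 < G 1).
{ unfold G, wz, s; pose proof (atan_bound (1 / tau)); pose proof PI_4.
  unfold tau in *; lra. }
rewrite F0, F1, HGodd in Hinc; nra.
Qed.

(** * Existence of an unstable mode *)

Lemma tg_continuous alpha eps s z : 0 < s ->
  continuous (tg_re alpha eps s) z /\ continuous (tg_im eps s) z.
Proof.
intros Hs.
assert (HA : ex_derive (ReX s) z) by (eexists; now apply is_derive_ReX).
assert (HB : ex_derive (ImX s) z) by (eexists; now apply is_derive_ImX).
assert (HU : ex_derive U'' z).
{ pose proof (wz_pos z); unfold U'', wz in *; auto_derive.
  apply Rgt_not_eq; repeat apply Rmult_lt_0_compat; simpl in *; lra. }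
split; apply (ex_derive_continuous (V := R_NormedModule));
  unfold tg_re, tg_im; auto_derive; tauto.
Qed.

Lemma shooting_exists alpha eps s :
  0 < s -> Rabs alpha <= 1 -> Rabs eps <= 1 ->
  exists a b a1 b1, shooting (tg_re alpha eps s) (tg_im eps s) a b a1 b1.
Proof.
intros Hs Ha He.
destruct (ode_exists (tg_re alpha eps s) (tg_im eps s) (1 + 6 * / s + 2 * (/ s) ^ 2))
  as [a [b [a1 [b1 H]]]].
- intros t; now apply tg_continuous.
- intros t; now apply tg_continuous.
- intros t; apply (proj1 (tg_bound s alpha eps s t Hs (Rle_refl s) Ha He)).
- intros t; apply (proj2 (tg_bound s alpha eps s t Hs (Rle_refl s) Ha He)).
- now exists a, b, a1, b1.
Qed.

Lemma Rmax_lipschitz c s t : Rabs (Rmax c s - Rmax c t) <= Rabs (s - t).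
Proof.
unfold Rmax; destruct (Rle_dec c s), (Rle_dec c t); unfold Rabs;
  repeat destruct Rcase_abs; lra.
Qed.

Lemma lipschitz_continuity (f : R -> R) (L : R) :
  (forall s t, Rabs (f s - f t) <= L * Rabs (s - t)) -> continuity f.
Proof.
intros H s; apply continuity_pt_filterlim, filterlim_locally; intros e.
assert (HL : 0 <= L).
{ specialize (H 1 0); rewrite Rminus_0_r, Rabs_R1 in H.
  pose proof (Rabs_pos (f 1 - f 0)); lra. }
assert (Hd : 0 < e / (L + 1)) by (apply Rdiv_lt_0_compat; [apply cond_pos|lra]).
exists (mkposreal _ Hd); intros t Ht.
change (Rabs (t - s) < e / (L + 1)) in Ht; change (Rabs (f t - f s) < e).
apply (Rlt_div_r _ _ (L + 1)) in Ht; [|lra].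
specialize (H t s); pose proof (Rabs_pos (t - s)); nra.
Qed.

Lemma neutral_perturbation C d m : 0 < d ->
  exists eta, 0 < eta <= 1 /\ forall alpha eps,
    Rabs alpha <= eta -> 0 <= eps <= eta -> C * (alpha ^ 2 + 2 * eps * m ^ 2) < d.
Proof.
intros Hd.
set (B := Rabs C * (1 + 2 * m ^ 2) + 1).
pose proof (pow2_ge_0 m) as Hm; pose proof (Rabs_pos C) as HC.
assert (HB : 1 <= B) by (unfold B; nra).
exists (Rmin 1 (d / B)); set (eta := Rmin 1 (d / B)).
assert (0 < d / B) by (apply Rdiv_lt_0_compat; lra).
assert (He1 : eta <= 1) by apply Rmin_l.
assert (He0 : 0 < eta) by (apply Rmin_glb_lt; lra).
assert (He2 : eta * B <= d) by (apply (proj2 (Rle_div_r _ _ B ltac:(lra))); apply Rmin_r).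
split; [lra|]; intros alpha eps Ha Heps.
assert (Ha2 : alpha ^ 2 <= eta).
{ apply Rle_trans with (eta ^ 2); [apply pow_maj_Rabs; auto|nra]. }
pose proof (pow2_ge_0 alpha).
assert (Hx : alpha ^ 2 + 2 * eps * m ^ 2 <= eta * (1 + 2 * m ^ 2)).
{ assert (eps * m ^ 2 <= eta * m ^ 2) by (apply Rmult_le_compat_r; lra); lra. }
assert (0 <= eps * m ^ 2) by (apply Rmult_le_pos; lra).
apply Rle_lt_trans with (Rabs C * (alpha ^ 2 + 2 * eps * m ^ 2)).
- apply Rmult_le_compat_r; [lra|apply Rle_abs].
- apply Rle_lt_trans with (Rabs C * (eta * (1 + 2 * m ^ 2))).
  + apply Rmult_le_compat_l; auto.
  + unfold B in He2; nra.
Qed.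

Lemma U_odd z : U (- z) = - U z.
Proof. unfold U, wz; pose proof (wz_pos z); unfold wz in *; field; simpl in *; repeat split; nra. Qed.

Lemma U''_odd z : U'' (- z) = - U'' z.
Proof. unfold U'', wz; pose proof (wz_pos z); unfold wz in *; field; simpl in *; repeat split; nra. Qed.

Lemma tg_parity alpha eps s z : 0 < s ->
  tg_re alpha eps s (- z) = tg_re alpha eps s z /\ tg_im eps s (- z) = - tg_im eps s z.
Proof.
intros Hs; pose proof (chi_pos s z Hs).
assert (HA : ReX s (- z) = - ReX s z) by (unfold ReX; rewrite U_odd; field; nra).
assert (HB : ImX s (- z) = ImX s z) by (unfold ImX; rewrite U_odd; f_equal; ring).
unfold tg_re, tg_im; rewrite HA, HB, U''_odd; split; ring.
Qed.

Lemma unstable_mode :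
  exists eta, 0 < eta /\ forall alpha eps, Rabs alpha <= eta -> 0 <= eps <= eta ->
    exists s, 0 < s /\ exists a b a1 b1,
      shooting (tg_re alpha eps s) (tg_im eps s) a b a1 b1 /\ a 1 = 0 /\ b 1 = 0.
Proof.
(* Any positive bound not above 1/250 keeps both test values of [s] in the range where the estimates
   are uniform. *)
set (sigma := 1 / 500).
assert (Hsig : 0 < sigma <= 1) by (unfold sigma; lra).
set (K := 1 + 6 * / sigma + 2 * (/ sigma) ^ 2).
set (C := 3 * exp (2 * (2 * K + 2))).
assert (HC : 0 < C) by (unfold C; pose proof (exp_pos (2 * (2 * K + 2))); lra).
assert (H0 : Rabs 0 <= 1) by (rewrite Rabs_R0; lra).
destruct (shooting_exists 0 0 (1 / 250)) as [an [bn [an1 [bn1 Hn]]]]; auto; try lra.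
destruct (shooting_exists 0 0 1) as [ap [bp [ap1 [bp1 Hp]]]]; auto; try lra.
pose proof (neutral_end_neg _ _ _ _ Hn) as Hneg.
pose proof (neutral_end_pos _ _ _ _ Hp) as Hpos.
destruct (neutral_perturbation C (Rmin (- an 1) (ap 1)) (/ sigma)) as [eta [Heta Hpert]].
{ apply Rmin_glb_lt; lra. }
exists eta; split; [lra|]; intros alpha eps Ha He.
specialize (Hpert alpha eps Ha He).
assert (Ha1 : Rabs alpha <= 1) by lra.
assert (He1 : Rabs eps <= 1) by (rewrite Rabs_pos_eq; lra).
(* Clamping extends the shooting function to all real [s], as [IVT_gen] asks for continuity
   everywhere; the phase speed finally returned is [cl s]. *)
set (cl := fun s => Rmax sigma s).
assert (Hcl : forall s, sigma <= cl s) by (intros; apply Rmax_l).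
assert (Hsol : forall s, exists a, exists b a1 b1,
  shooting (tg_re alpha eps (cl s)) (tg_im eps (cl s)) a b a1 b1).
{ intros s; apply shooting_exists; auto; specialize (Hcl s); lra. }
(* One solution is selected for each [s] without any regularity; [shooting_stable] compares
   arbitrary solutions, so the selection is Lipschitz at z = 1. *)
destruct (functional_choice _ Hsol) as [y Hy].
assert (Hlip : forall s t, Rabs (y s 1 - y t 1) <= (C * (20 * (/ sigma) ^ 3)) * Rabs (s - t)).
{ intros s t; destruct (Hy s) as [b [a1 [b1 Hs]]], (Hy t) as [b' [a1' [b1' Ht]]].
  apply Rle_trans with (C * (20 * (/ sigma) ^ 3 * Rabs (cl s - cl t))).
  - apply (shooting_stable K _ _ _ _ _ _ _ _ _ _ _ _ _
      (fun z _ => tg_bound sigma alpha eps (cl s) z (proj1 Hsig) (Hcl s) Ha1 He1)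
      (fun z _ => tg_bound sigma alpha eps (cl t) z (proj1 Hsig) (Hcl t) Ha1 He1)
      (fun z _ => tg_lipschitz sigma alpha eps (cl s) (cl t) z Hsig (Hcl s) (Hcl t) He1) Hs Ht).
  - pose proof (Rmax_lipschitz sigma s t).
    assert (0 <= C * (20 * (/ sigma) ^ 3)).
    { pose proof (Rinv_0_lt_compat sigma (proj1 Hsig)).
      pose proof (pow_lt (/ sigma) 3 H1); nra. }
    rewrite <- !Rmult_assoc in *; apply Rmult_le_compat_l; auto. }
assert (Hnear : forall s a b a1 b1, sigma <= s ->
   shooting (tg_re 0 0 s) (tg_im 0 s) a b a1 b1 ->
   Rabs (y s 1 - a 1) < Rmin (- an 1) (ap 1)).
{ intros s a b a1 b1 Hs Hsh; destruct (Hy s) as [b' [a1' [b1' Hs']]].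
  assert (Ecl : cl s = s) by (apply Rmax_right; auto); rewrite Ecl in Hs'.
  eapply Rle_lt_trans; [|apply Hpert].
  apply (shooting_stable K _ _ _ _ _ _ _ _ _ _ _ _ _
      (fun z _ => tg_bound sigma alpha eps s z (proj1 Hsig) Hs Ha1 He1)
      (fun z _ => tg_bound sigma 0 0 s z (proj1 Hsig) Hs H0 H0)
      (fun z _ => tg_perturb sigma alpha eps s z (proj1 Hsig) Hs (proj1 He)) Hs' Hsh). }
assert (Hsn : sigma <= 1 / 250) by (unfold sigma; lra).
pose proof (Hnear _ _ _ _ _ Hsn Hn) as Hyn.
pose proof (Hnear _ _ _ _ _ (proj2 Hsig) Hp) as Hyp.
apply Rabs_def2 in Hyn; apply Rabs_def2 in Hyp.
pose proof (Rmin_l (- an 1) (ap 1)); pose proof (Rmin_r (- an 1) (ap 1)).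
destruct (IVT_gen (fun s => y s 1) (1 / 250) 1 0) as [s [_ Hs]].
- eapply lipschitz_continuity; apply Hlip.
- rewrite Rmin_left, Rmax_right by lra; lra.
- exists (cl s); specialize (Hcl s); split; [lra|].
  destruct (Hy s) as [b [a1 [b1 Hsh]]].
  exists (y s), b, a1, b1; split; [auto|split; [auto|]].
  assert (Hcp : 0 < cl s) by lra.
  apply (shooting_end_real _ _ _ _ _ _ (fun z => proj1 (tg_parity alpha eps (cl s) z Hcp))
    (fun z => proj2 (tg_parity alpha eps (cl s) z Hcp)) Hsh).
Qed.

(** * Smoothness, analyticity and Fourier modes *)

(** Global n-fold differentiability through exhibited derivatives: calculus rules and the bootstrap
    along the equation become inductions on [n], without computing with [Derive]. *)
Fixpoint diffn (n : nat) (f : R -> R) : Prop :=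
  match n with
  | O => True
  | S m => exists g : R -> R, (forall z, is_derive f z (g z)) /\ diffn m g
  end.

Lemma diffn_pred n f : diffn (S n) f -> diffn n f.
Proof.
revert f; induction n as [|n IH]; intros f; [simpl; auto|].
intros [g [Hg Hn]]; exists g; split; auto.
Qed.

Lemma diffn_ext n f g : (forall z, f z = g z) -> diffn n f -> diffn n g.
Proof. intros H; now replace g with f by (now apply functional_extensionality). Qed.

Lemma diffn_const n c : diffn n (fun _ => c).
Proof.
revert c; induction n as [|n IH]; intros c; simpl; auto.
exists (fun _ => 0); split; auto.
intros z; apply (is_derive_const (V := R_NormedModule)).
Qed.

Lemma diffn_id n : diffn n (fun z => z).
Proof.
destruct n as [|n]; simpl; auto.
exists (fun _ => 1); split; [intros z; apply (is_derive_id (K := R_AbsRing))|apply diffn_const].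
Qed.

Lemma diffn_plus n f g : diffn n f -> diffn n g -> diffn n (fun z => f z + g z).
Proof.
revert f g; induction n as [|n IH]; intros f g; simpl; auto.
intros [f' [Hf Hf']] [g' [Hg Hg']]; exists (fun z => f' z + g' z); split; auto.
intros z; now apply (is_derive_plus (V := R_NormedModule)).
Qed.

Lemma diffn_mult n f g : diffn n f -> diffn n g -> diffn n (fun z => f z * g z).
Proof.
revert f g; induction n as [|n IH]; intros f g; [simpl; auto|].
intros Hfn Hgn; pose proof (diffn_pred _ _ Hfn); pose proof (diffn_pred _ _ Hgn).
destruct Hfn as [f' [Hf Hf']], Hgn as [g' [Hg Hg']].
exists (fun z => f' z * g z + f z * g' z); split; [|apply diffn_plus; auto].
intros z; apply (is_derive_mult (K := R_AbsRing)); auto; intros; apply Rmult_comm.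
Qed.

Lemma diffn_opp n f : diffn n f -> diffn n (fun z => - f z).
Proof.
intros H; apply diffn_ext with (fun z => (-1) * f z); [intros; ring|].
apply diffn_mult; auto; apply diffn_const.
Qed.

Lemma diffn_minus n f g : diffn n f -> diffn n g -> diffn n (fun z => f z - g z).
Proof. intros; apply diffn_plus; auto; now apply diffn_opp. Qed.

Lemma diffn_pow n f k : diffn n f -> diffn n (fun z => f z ^ k).
Proof.
intros H; induction k as [|k IH]; [apply (diffn_const n 1)|now apply (diffn_mult n f (fun z => f z ^ k))].
Qed.

Lemma diffn_inv n f : (forall z, f z <> 0) -> diffn n f -> diffn n (fun z => / f z).
Proof.
intros Hnz; induction n as [|n IH]; [simpl; auto|].
intros Hfn; pose proof (diffn_pred _ _ Hfn).
destruct Hfn as [f' [Hf Hf']].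
exists (fun z => - f' z * (/ f z * / f z)); split.
- intros z; replace (- f' z * _) with (- f' z / f z ^ 2) by (field; auto).
  now apply is_derive_inv.
- apply diffn_mult; [now apply diffn_opp|apply diffn_mult; auto].
Qed.

Lemma diffn_div n f g :
  (forall z, g z <> 0) -> diffn n f -> diffn n g -> diffn n (fun z => f z / g z).
Proof. intros; apply diffn_mult; auto; now apply diffn_inv. Qed.

Ltac diffn_solve := repeat first
  [ assumption | apply diffn_minus | apply diffn_opp | apply diffn_const | apply diffn_id
  | apply diffn_pow | apply diffn_div | apply diffn_plus | apply diffn_mult ].

Lemma diffn_ex_derive_n n f : (forall m, diffn m f) -> forall z, ex_derive_n f n z.
Proof.
intros Hf; specialize (Hf n); revert f Hf; induction n as [|n IH]; intros f Hf z; [exact I|].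
destruct n as [|n].
- destruct Hf as [g [Hg _]]; eexists; apply Hg.
- destruct Hf as [g [Hg Hn]].
  assert (E : Derive f = g) by (apply functional_extensionality; intros; now apply is_derive_unique).
  specialize (IH g Hn z); simpl in IH |- *.
  apply ex_derive_ext with (2 := IH); intros t.
  rewrite <- E; clear.
  change (Derive_n (Derive_n f 1) n t = Derive_n f (S n) t).
  rewrite Derive_n_comp; f_equal; lia.
Qed.

(** Bootstrap: y' differentiates y, and (p + i r) y differentiates y', so y and y' gain one order
    together at each step. *)
Lemma ode_solution_diffn p r a b a1 b1 :
  ode_solution p r a b a1 b1 -> (forall n, diffn n p) -> (forall n, diffn n r) ->
  forall n, diffn n a /\ diffn n b.
Proof.
intros H Hp Hr.
assert (HA : forall n, (diffn n a /\ diffn n b) /\ diffn n a1 /\ diffn n b1).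
{ induction n as [|n [[IHa IHb] [IHa1 IHb1]]]; [simpl; auto|].
  split; split.
  - exists a1; split; auto; intros z; apply H.
  - exists b1; split; auto; intros z; apply H.
  - exists (fun z => p z * a z - r z * b z); split; [intros z; apply H|].
    specialize (Hp n); specialize (Hr n); diffn_solve.
  - exists (fun z => r z * a z + p z * b z); split; [intros z; apply H|].
    specialize (Hp n); specialize (Hr n); diffn_solve. }
intros n; apply HA.
Qed.

Lemma diffn_continuity n f : diffn (S n) f -> continuity f.
Proof.
intros [g [Hg _]] z.
apply continuity_pt_filterlim, (ex_derive_continuous (V := R_NormedModule)); eexists; apply Hg.
Qed.

(** This family is stable under both partial derivatives. The order S n is assumed because
    [ex_diff_n] also demands continuity of the n-th partials. *)
Lemma ex_diff_n_trig kappa n g1 g2 x y : diffn (S n) g1 -> diffn (S n) g2 ->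
  ex_diff_n (fun u v => g1 v * cos (kappa * u) + g2 v * sin (kappa * u)) n x y.
Proof.
revert g1 g2; induction n as [|n IH]; intros g1 g2 H1 H2;
(assert (Hc : continuity_2d_pt (fun u v => g1 v * cos (kappa * u) + g2 v * sin (kappa * u)) x y);
 [ apply continuity_2d_pt_plus; apply continuity_2d_pt_mult;
   [ apply (continuity_1d_2d_pt_comp g1 (fun _ v => v));
       [eapply diffn_continuity; eauto|apply continuity_2d_pt_id2]
   | apply (continuity_1d_2d_pt_comp (fun t => cos (kappa * t)) (fun u _ => u));
       [reg|apply continuity_2d_pt_id1]
   | apply (continuity_1d_2d_pt_comp g2 (fun _ v => v));
       [eapply diffn_continuity; eauto|apply continuity_2d_pt_id2]
   | apply (continuity_1d_2d_pt_comp (fun t => sin (kappa * t)) (fun u _ => u));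
       [reg|apply continuity_2d_pt_id1] ]
 | split; [exact Hc|] ]); [exact I|].
pose proof (diffn_pred _ _ H1) as H1'; pose proof (diffn_pred _ _ H2) as H2'.
destruct H1 as [d1 [Hd1 Hn1]], H2 as [d2 [Hd2 Hn2]].
assert (Hu : forall u v, is_derive (fun z => g1 v * cos (kappa * z) + g2 v * sin (kappa * z)) u
    (kappa * g2 v * cos (kappa * u) + - kappa * g1 v * sin (kappa * u))).
{ intros u v; auto_derive; auto; ring. }
assert (Hv : forall u v, is_derive (fun z => g1 z * cos (kappa * u) + g2 z * sin (kappa * u)) v
    (d1 v * cos (kappa * u) + d2 v * sin (kappa * u))).
{ intros u v; assert (ex_derive g1 v) by (eexists; apply Hd1).
  assert (ex_derive g2 v) by (eexists; apply Hd2).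
  auto_derive; auto.
  rewrite (is_derive_unique (fun z : R => g1 z) _ _ (Hd1 v)),
    (is_derive_unique (fun z : R => g2 z) _ _ (Hd2 v)); ring. }
split; [eexists; apply Hu|split; [eexists; apply Hv|split]].
- replace (fun u v : R => Derive _ u) with
    (fun u v => (kappa * g2 v) * cos (kappa * u) + (- kappa * g1 v) * sin (kappa * u)).
  + apply IH; apply diffn_mult; auto; apply diffn_const.
  + apply functional_extensionality; intros u; apply functional_extensionality; intros v.
    symmetry; apply is_derive_unique, Hu.
- replace (fun u v : R => Derive _ v) with
    (fun u v => d1 v * cos (kappa * u) + d2 v * sin (kappa * u)).
  + apply IH; auto.
  + apply functional_extensionality; intros u; apply functional_extensionality; intros v.
    symmetry; apply is_derive_unique, Hv.
Qed.

Lemma smooth_profile_diffn (f : R -> C) :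
  (forall n, diffn n (fun z => Re (f z)) /\ diffn n (fun z => Im (f z))) -> smooth_profile f.
Proof.
intros H; exists 1; split; [lra|]; intros n z _.
split; apply diffn_ex_derive_n; intros m; apply H.
Qed.

Lemma smooth_field_fourier_mode M f : 0 < M ->
  (forall n, diffn n (fun z => Re (f z)) /\ diffn n (fun z => Im (f z))) ->
  smooth_field M (fourier_mode M 1 f).
Proof.
intros HM Hf; split.
- intros x z _; unfold fourier_mode; f_equal; unfold expi.
  replace (1 / M * (x + 2 * PI * M)) with (1 / M * x + 2 * INR 1 * PI) by (simpl; field; lra).
  now rewrite cos_period, sin_period.
- exists 1; split; [lra|]; intros n x z _; destruct (Hf (S n)) as [H1 H2]; split.
  + replace (fun u v => Re (fourier_mode M 1 f u v)) with
      (fun u v => Re (f v) * cos (1 / M * u) + (- Im (f v)) * sin (1 / M * u)).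
    * apply ex_diff_n_trig; auto; now apply diffn_opp.
    * apply functional_extensionality; intros u; apply functional_extensionality; intros v.
      unfold fourier_mode, expi, Re, Im; simpl; ring.
  + replace (fun u v => Im (fourier_mode M 1 f u v)) with
      (fun u v => Im (f v) * cos (1 / M * u) + Re (f v) * sin (1 / M * u)).
    * apply ex_diff_n_trig; auto.
    * apply functional_extensionality; intros u; apply functional_extensionality; intros v.
      unfold fourier_mode, expi, Re, Im; simpl; ring.
Qed.

Lemma dx_fourier_mode M k f :
  dx (fourier_mode M k f) =
  fourier_mode M k (fun z => (- (IZR k / M) * Im (f z), IZR k / M * Re (f z))).
Proof.
apply functional_extensionality; intros x; apply functional_extensionality; intros z.
unfold dx, CDerive, fourier_mode, expi, Re, Im; simpl.
apply injective_projections; simpl; apply is_derive_unique; auto_derive; auto; ring.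
Qed.

Lemma dz_fourier_mode M k f g :
  (forall z, is_derive (fun z => Re (f z)) z (Re (g z)) /\
             is_derive (fun z => Im (f z)) z (Im (g z))) ->
  dz (fourier_mode M k f) = fourier_mode M k g.
Proof.
intros H.
apply functional_extensionality; intros x; apply functional_extensionality; intros z.
destruct (H z) as [H1 H2]; unfold Re, Im in H1, H2.
unfold dz, CDerive, fourier_mode, expi, Re, Im; simpl.
apply injective_projections; simpl; apply is_derive_unique.
- apply (is_derive_minus (V := R_NormedModule));
    now apply (is_derive_scal_l (K := R_AbsRing) (V := R_NormedModule)).
- apply (is_derive_plus (V := R_NormedModule));
    now apply (is_derive_scal_l (K := R_AbsRing) (V := R_NormedModule)).
Qed.

Lemma is_pseries_affine c0 c1 x :
  is_pseries (fun n => match n with O => c0 | S O => c1 | _ => 0 end) x (c0 + c1 * x).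
Proof.
unfold is_pseries, is_series.
apply filterlim_ext_loc with (fun _ : nat => c0 + c1 * x); [|apply filterlim_const].
exists 1%nat; intros n Hn; destruct n as [|n]; [lia|].
induction n as [|n IH].
- rewrite sum_Sn, sum_O; unfold scal, plus, mult, one; simpl; unfold mult, one; simpl; ring.
- rewrite sum_Sn, <- IH by lia; unfold scal, plus; simpl; unfold mult; simpl; ring.
Qed.

Lemma analytic_linear c : analytic_on_channel (fun z => c * z).
Proof.
intros z0 _; exists (fun n => match n with O => c * z0 | S O => c | _ => 0 end), 1.
split; [lra|]; intros z _.
replace (c * z) with (c * z0 + c * (z - z0)) by ring; apply is_pseries_affine.
Qed.

(* Coefficients at [z0] from [(x^2 + 2 z0 x + wz z0) * sum u_n x^n = z0 + x],
   stored as consecutive pairs [(u_n, u_(n+1))]. *)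
Fixpoint U_coef_pair (z0 : R) (n : nat) : R * R :=
  match n with
  | O => (U z0, (1 - 2 * z0 * U z0) / wz z0)
  | S m => let u := U_coef_pair z0 m in
      (snd u, - (2 * z0 * snd u + fst u) / wz z0)
  end.

Definition U_coef (z0 : R) (n : nat) : R := fst (U_coef_pair z0 n).

Lemma U_coef_rec z0 n :
  U_coef z0 (S (S n)) = - (2 * z0 * U_coef z0 (S n) + U_coef z0 n) / wz z0.
Proof. reflexivity. Qed.

(** As [wz z0] >= 1 and |2 z0| <= 2, the recursion is dominated by u_(n+2) = 2 u_(n+1) + u_n, whose
    growth rate 1 + sqrt 2 is below 3. Convergence for |x| < 1/4 follows. *)
Lemma U_coef_bound z0 n : -1 <= z0 <= 1 -> Rabs (U_coef z0 n) <= 2 * 3 ^ n.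
Proof.
intros Hz.
pose proof (wz_ge z0) as Hw.
assert (Hz2 : Rabs (2 * z0) <= 2) by (apply Rabs_le; lra).
assert (Hdiv : forall t c, Rabs t <= c -> Rabs (t / wz z0) <= c).
{ intros t c Ht; rewrite Rabs_div, (Rabs_pos_eq (wz z0)) by lra.
  pose proof (Rabs_pos t).
  apply Rle_div_l; [lra|nra]. }
assert (H : Rabs (U_coef z0 n) <= 2 * 3 ^ n /\ Rabs (U_coef z0 (S n)) <= 2 * 3 ^ S n).
{ induction n as [|n [IH1 IH2]].
  - pose proof (U_bound z0) as HU; unfold U_coef; simpl; split; [lra|].
    apply Hdiv; apply Rle_trans with (1 + 2 * 1); [|lra].
    apply Rabs_minus_le; [rewrite Rabs_R1; lra|now apply Rabs_mult_le].
  - split; auto; rewrite U_coef_rec; apply Hdiv; rewrite Rabs_Ropp.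
    apply Rle_trans with (2 * (2 * 3 ^ S n) + 2 * 3 ^ n).
    + apply Rabs_plus_le; auto; now apply Rabs_mult_le.
    + pose proof (pow_lt 3 n); simpl; lra. }
apply H.
Qed.

Lemma analytic_U : analytic_on_channel U.
Proof.
intros z0 Hz; exists (U_coef z0), (1 / 4); split; [lra|]; intros z Hr.
set (x := z - z0) in *.
assert (Hex : ex_pseries (U_coef z0) x).
{ apply (ex_series_le (K := R_AbsRing) (V := R_CompleteNormedModule) _
    (fun n => 2 * (3 / 4) ^ n)).
  - intros n; unfold scal, norm; simpl; unfold mult, abs; simpl.
    rewrite pow_n_pow, Rabs_mult, <- RPow_abs.
    pose proof (U_coef_bound z0 n Hz) as Hb.
    apply Rle_trans with ((1 / 4) ^ n * (2 * 3 ^ n)).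
    + apply Rmult_le_compat; auto using Rabs_pos, pow_le.
      apply pow_incr; split; [apply Rabs_pos|lra].
    + right; replace (3 / 4) with (1 / 4 * 3) by field; rewrite Rpow_mult_distr; ring.
  - apply (ex_series_scal (K := R_AbsRing) (V := R_NormedModule) 2), ex_series_geom.
    rewrite Rabs_pos_eq; lra. }
pose proof (wz_pos z0) as Hw.
(* Shifting the series twice turns the recursion into the linear relation [E2] between sums.
   Eliminating the shifted sums leaves [wz z] times the sum equal to z. *)
set (d1 := PS_decr_1 (U_coef z0)); set (d2 := PS_decr_1 d1).
assert (Hx : x = 0 \/ exists y, y * x = 1).
{ destruct (Req_dec x 0) as [Hx|Hx]; [now left|right].
  exists (/ x); now apply Rinv_l. }
assert (Hex1 : ex_pseries d1 x) by (now apply ex_pseries_decr_1).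
assert (Hex2 : ex_pseries d2 x) by (now apply ex_pseries_decr_1).
assert (E0 : PSeries (U_coef z0) x = U z0 + x * PSeries d1 x) by (now apply PSeries_decr_1).
assert (E1 : PSeries d1 x = (1 - 2 * z0 * U z0) / wz z0 + x * PSeries d2 x)
  by (now apply PSeries_decr_1).
assert (E2 : PSeries d2 x
   = - (2 * z0 * PSeries d1 x + PSeries (U_coef z0) x) / wz z0).
{ rewrite <- PSeries_scal, <- PSeries_plus; auto.
  2: { apply ex_pseries_scal; auto; apply Rmult_comm. }
  replace (- _ / _) with (- / wz z0 * PSeries (PS_plus (PS_scal (2 * z0) d1) (U_coef z0)) x)
    by (field; lra).
  rewrite <- PSeries_scal; apply PSeries_ext; intros n.
  unfold d2, d1, PS_decr_1, PS_scal, PS_plus; rewrite U_coef_rec.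
  unfold scal, plus; simpl; unfold mult; simpl; field; lra. }
replace (U z) with (PSeries (U_coef z0) x); [now apply PSeries_correct|].
assert (Hwz : wz z = wz z0 + 2 * z0 * x + x ^ 2) by (unfold wz, x; ring).
assert (Hz' : U z0 * wz z0 = z0) by (unfold U; field; lra).
pose proof (wz_pos z).
unfold U; apply Rmult_eq_reg_r with (wz z); [|lra].
replace (z / wz z * wz z) with (z0 + x) by (unfold x; field; lra).
rewrite Hwz.
assert (E1' : wz z0 * PSeries d1 x = 1 - 2 * z0 * U z0 + x * (wz z0 * PSeries d2 x))
  by (rewrite E1; field; lra).
assert (E2' : wz z0 * PSeries d2 x = - (2 * z0 * PSeries d1 x + PSeries (U_coef z0) x))
  by (rewrite E2; field; lra).
rewrite E2' in E1'.
assert (E0' : wz z0 * PSeries (U_coef z0) x = z0 + x * (wz z0 * PSeries d1 x))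
  by (rewrite E0, Rmult_plus_distr_l, (Rmult_comm (wz z0) (U z0)), Hz'; ring).
rewrite E1' in E0'.
transitivity (wz z0 * PSeries (U_coef z0) x + (2 * z0 * x + x ^ 2) * PSeries (U_coef z0) x);
  [ring|].
rewrite E0', E0; ring.
Qed.

(** * The eigenfunction *)

Lemma diffn_wz n : diffn n wz.
Proof. unfold wz; diffn_solve. Qed.

Lemma wz_neq0 z : wz z <> 0.
Proof. pose proof (wz_pos z); lra. Qed.

Lemma diffn_U n : diffn n U.
Proof. pose proof (diffn_wz n); unfold U; diffn_solve; apply wz_neq0. Qed.

Lemma diffn_U'' n : diffn n U''.
Proof.
pose proof (diffn_wz n); unfold U''; diffn_solve.
intros z; apply pow_nonzero, wz_neq0.
Qed.

Lemma diffn_ReX_ImX n s : 0 < s -> diffn n (ReX s) /\ diffn n (ImX s).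
Proof.
intros Hs; pose proof (diffn_U n).
assert (forall z, U z ^ 2 + s ^ 2 <> 0) by (intros z; pose proof (chi_pos s z Hs); lra).
split; unfold ReX, ImX; diffn_solve; auto.
Qed.

Lemma diffn_tg n alpha eps s : 0 < s ->
  diffn n (tg_re alpha eps s) /\ diffn n (tg_im eps s).
Proof.
intros Hs; destruct (diffn_ReX_ImX n s Hs); pose proof (diffn_U'' n).
split; unfold tg_re, tg_im; diffn_solve.
Qed.

Lemma Derive_linear c z : Derive (fun z => c * z) z = c.
Proof. apply is_derive_unique; auto_derive; auto; ring. Qed.

Lemma Derive_n_U z : Derive_n U 2 z = U'' z.
Proof.
simpl; rewrite (Derive_ext _ U').
- apply is_derive_unique, is_derive_U'.
- intros t; apply is_derive_unique, is_derive_U.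
Qed.

Section Mode.

Variables (M eps s : R) (a b a1 b1 : R -> R).
Hypothesis M_pos : 0 < M.
Hypothesis eps_pos : 0 < eps.
Hypothesis s_pos : 0 < s.
Let alpha := 1 / M.
Hypothesis sol : shooting (tg_re alpha eps s) (tg_im eps s) a b a1 b1.
Hypothesis a_end : a 1 = 0.
Hypothesis b_end : b 1 = 0.

Let phihat (z : R) : C := (a z, b z).
(** This is - eps phihat / (U - i s): the density equation with lambda = alpha s reads i alpha (U -
    i s) rhohat = - i alpha eps phihat. *)
Let rhohat (z : R) : C :=
  (- eps * (ReX s z * a z - ImX s z * b z), - eps * (ReX s z * b z + ImX s z * a z)).
Let p (z : R) : R := tg_re alpha eps s z - alpha ^ 2.
(** The Taylor-Goldstein coefficient without its alpha^2 acts on phihat, so this is phihat'' -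
    alpha^2 phihat, the Laplacian of the mode. *)
Let omegahat (z : R) : C :=
  (p z * a z - tg_im eps s z * b z, tg_im eps s z * a z + p z * b z).

Lemma mode_smooth n :
  (diffn n (fun z => Re (phihat z)) /\ diffn n (fun z => Im (phihat z))) /\
  (diffn n (fun z => Re (rhohat z)) /\ diffn n (fun z => Im (rhohat z))) /\
  (diffn n (fun z => Re (omegahat z)) /\ diffn n (fun z => Im (omegahat z))).
Proof.
destruct (ode_solution_diffn _ _ _ _ _ _ (proj1 sol)
  (fun n => proj1 (diffn_tg n alpha eps s s_pos))
  (fun n => proj2 (diffn_tg n alpha eps s s_pos)) n) as [Ha Hb].
destruct (diffn_ReX_ImX n s s_pos), (diffn_tg n alpha eps s s_pos).
unfold phihat, rhohat, omegahat, p, Re, Im; simpl; repeat split; diffn_solve.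
Qed.

(** The slope of [a] at -1 is 1, so a short difference quotient from there cannot vanish. *)
Lemma mode_nonzero : exists z, -1 <= z <= 1 /\ a z <> 0.
Proof.
destruct sol as [Hode [Ha0 [_ [Ha1 _]]]].
destruct (Hode (-1)) as [H _]; rewrite Ha1 in H.
apply is_derive_Reals in H; destruct (H 1 Rlt_0_1) as [d Hd].
set (h := Rmin (d / 2) 1).
pose proof (cond_pos d).
assert (Hh : 0 < h) by (apply Rmin_glb_lt; lra).
assert (Hh1 : h <= 1) by apply Rmin_r.
assert (Hh2 : h <= d / 2) by apply Rmin_l.
exists (-1 + h); split; [lra|]; intros E.
specialize (Hd h); rewrite E, Ha0 in Hd.
replace ((0 - 0) / h - 1) with (- (1)) in Hd by (field; lra).
rewrite Rabs_Ropp, Rabs_R1, Rabs_pos_eq in Hd by lra.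
assert (1 < 1) by (apply Hd; lra); lra.
Qed.

(** Where phihat is nonzero, so is rhohat. For omegahat, put X = 1/(U - i s): a zero would require X
    (U'' - eps X) = 0, making X = U'' / eps real, but Im X > 0. *)
Lemma mode_profiles_nonzero : nonzero_profile rhohat /\ nonzero_profile omegahat.
Proof.
destruct mode_nonzero as [z [Hz Ha]].
pose proof (chi_pos s z s_pos) as Hchi.
assert (HB : ImX s z <> 0).
{ unfold ImX; apply Rgt_not_eq, Rdiv_lt_0_compat; lra. }
assert (Hab : 0 < a z ^ 2 + b z ^ 2).
{ pose proof (pow2_ge_0 (b z)); pose proof (pow2_gt_0 (a z) Ha); lra. }
assert (HAB : 0 < ReX s z ^ 2 + ImX s z ^ 2).
{ pose proof (pow2_ge_0 (ReX s z)); pose proof (pow2_gt_0 (ImX s z) HB); lra. }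
split; exists z; split; auto; intros E; injection E; intros E2 E1.
- assert (Hp : (eps ^ 2 * (ReX s z ^ 2 + ImX s z ^ 2)) * (a z ^ 2 + b z ^ 2) = 0).
  { transitivity ((- eps * (ReX s z * a z - ImX s z * b z)) ^ 2 +
      (- eps * (ReX s z * b z + ImX s z * a z)) ^ 2); [ring|rewrite E1, E2; ring]. }
  assert (0 < eps ^ 2) by (apply pow_lt; auto).
  assert (0 < eps ^ 2 * (ReX s z ^ 2 + ImX s z ^ 2)) by (apply Rmult_lt_0_compat; auto).
  apply Rmult_integral in Hp; lra.
- assert (Hp : (p z ^ 2 + tg_im eps s z ^ 2) * (a z ^ 2 + b z ^ 2) = 0).
  { transitivity ((p z * a z - tg_im eps s z * b z) ^ 2 +
      (tg_im eps s z * a z + p z * b z) ^ 2); [ring|rewrite E1, E2; ring]. }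
  apply Rmult_integral in Hp; destruct Hp as [Hp|Hp]; [|lra].
  pose proof (pow2_ge_0 (p z)); pose proof (pow2_ge_0 (tg_im eps s z)).
  assert (Hp0 : p z = 0) by (apply Rsqr_0_uniq; unfold Rsqr; lra).
  assert (Hr0 : tg_im eps s z = 0) by (apply Rsqr_0_uniq; unfold Rsqr; lra).
  assert (HU : U'' z = eps * (2 * ReX s z)).
  { apply Rmult_eq_reg_r with (ImX s z); auto; unfold tg_im in Hr0; lra. }
  unfold p, tg_re in Hp0; rewrite HU in Hp0.
  assert (eps * (ReX s z ^ 2 + ImX s z ^ 2) = 0) by lra.
  assert (0 < eps * (ReX s z ^ 2 + ImX s z ^ 2)) by (apply Rmult_lt_0_compat; auto); lra.
Qed.

Lemma mode_stream_function :
  stream_function M (fourier_mode M 1 omegahat) (fourier_mode M 1 phihat).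
Proof.
destruct sol as [Hode [Ha0 [Hb0 _]]].
split; [apply smooth_field_fourier_mode; auto; intros n; apply mode_smooth|split].
- intros x z _; unfold laplacian.
  rewrite !dx_fourier_mode.
  rewrite (dz_fourier_mode M 1 phihat (fun z => (a1 z, b1 z))).
  2: { intros t; destruct (Hode t) as [H1 [H2 _]]; split; auto. }
  rewrite (dz_fourier_mode M 1 (fun z => (a1 z, b1 z))
    (fun z => (tg_re alpha eps s z * a z - tg_im eps s z * b z,
               tg_im eps s z * a z + tg_re alpha eps s z * b z))).
  2: { intros t; destruct (Hode t) as [_ [_ [H3 H4]]]; split; auto. }
  unfold fourier_mode; rewrite <- Cmult_plus_distr_r; f_equal.
  unfold omegahat, phihat, p, alpha, Re, Im; simpl.
  apply injective_projections; simpl; field; lra.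
- intros x; unfold fourier_mode, phihat; rewrite Ha0, Hb0, a_end, b_end.
  split; apply injective_projections; simpl; ring.
Qed.

Lemma mode_eigenfunction :
  eigenfunction M (fun z => - eps * z) U (RtoC (alpha * s))
    (fourier_mode M 1 rhohat) (fourier_mode M 1 omegahat).
Proof.
split; [apply smooth_field_fourier_mode; auto; intros n; apply mode_smooth|].
split; [apply smooth_field_fourier_mode; auto; intros n; apply mode_smooth|].
split.
- destruct mode_profiles_nonzero as [[z [Hz Hn]] _].
  exists 0, z; split; auto; left; unfold fourier_mode, expi.
  rewrite Rmult_0_r, cos_0, sin_0; fold (RtoC 1); now rewrite Cmult_1_r.
- exists (fourier_mode M 1 phihat); split; [apply mode_stream_function|].
  intros x z _; rewrite !dx_fourier_mode, Derive_linear, Derive_n_U.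
  pose proof (chi_pos s z s_pos) as Hchi.
  unfold fourier_mode; fold alpha; generalize (expi (alpha * x)); intros e.
  split.
  + rewrite !Cmult_assoc, <- Cmult_plus_distr_r; f_equal.
    unfold rhohat, phihat, Re, Im, ReX, ImX.
    apply injective_projections; simpl; field; lra.
  + rewrite !Cmult_assoc, <- !Cmult_plus_distr_r; f_equal.
    unfold omegahat, rhohat, phihat, p, tg_re, tg_im, Re, Im, ReX, ImX.
    apply injective_projections; simpl; field; lra.
Qed.

End Mode.

Theorem theorem2p11 :
  exists rhos Us : R -> R,
    analytic_on_channel rhos /\ analytic_on_channel Us /\
    (forall z : R, -1 <= z <= 1 ->
       Derive rhos z < 0 /\ Derive Us z <> 0 /\
       0 < - Derive rhos z / (Rabs (Derive Us z)) ^ 2 < 1 / 4) /\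
    exists Mbar : R, 0 < Mbar /\
      forall M : R, Mbar < M ->
        exists lambda : C,
          eigenvalue M rhos Us lambda /\ 0 < Re lambda /\
          exists (k : Z) (rhohat omegahat : R -> C),
            k <> 0%Z /\
            smooth_profile rhohat /\ nonzero_profile rhohat /\
            smooth_profile omegahat /\ nonzero_profile omegahat /\
            eigenfunction M rhos Us lambda
              (fourier_mode M k rhohat) (fourier_mode M k omegahat).
Proof.
destruct unstable_mode as [eta [Heta Hmode]].
(* On the channel U' is least at the walls, where it equals 2/25; the Richardson number is then at
   most (1/1000) (625/4) = 5/32 < 1/4. *)
set (eps := Rmin eta (1 / 1000)).
assert (Heps : 0 < eps) by (apply Rmin_glb_lt; lra).
assert (Heps1 : eps <= eta) by apply Rmin_l.
assert (Heps2 : eps <= 1 / 1000) by apply Rmin_r.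
exists (fun z => - eps * z), U.
split; [apply analytic_linear|split; [apply analytic_U|split]].
- intros z Hz; rewrite Derive_linear, (is_derive_unique _ _ _ (is_derive_U z)).
  assert (HU : 2 / 25 <= U' z).
  { unfold U'; pose proof (wz_pos z) as Hw.
    apply (proj1 (Rle_div_r _ _ _ (pow_lt _ 2 Hw))); unfold wz in *.
    assert (0 <= z ^ 2 <= 1) by (split; nra); nra. }
  rewrite Rabs_pos_eq by lra.
  assert (HU2 : 4 / 625 <= U' z ^ 2) by nra.
  split; [lra|split; [lra|split]].
  + apply Rdiv_lt_0_compat; lra.
  + apply (proj2 (Rlt_div_l _ _ (U' z ^ 2) ltac:(lra))); lra.
(* With k = 1, M > 1 / eta means exactly alpha = 1 / M < eta. *)
- exists (1 / eta); split; [apply Rdiv_lt_0_compat; lra|]; intros M HM.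
  assert (HM0 : 0 < M) by (pose proof (Rdiv_lt_0_compat 1 eta Rlt_0_1 Heta); lra).
  destruct (Hmode (1 / M) eps) as [s [Hs [a [b [a1 [b1 [Hsol [Ha Hb]]]]]]]]; [|lra|].
  { rewrite Rabs_pos_eq by (left; apply Rdiv_lt_0_compat; lra).
    apply (Rlt_div_l 1 M eta) in HM; [|lra].
    apply (proj2 (Rle_div_l 1 eta M HM0)); lra. }
  pose proof (mode_eigenfunction M eps s a b a1 b1 HM0 Heps Hs Hsol Ha Hb) as He.
  pose proof (mode_profiles_nonzero M eps s a b a1 b1 Heps Hs Hsol) as [Hr Ho].
  pose proof (mode_smooth M eps s a b a1 b1 Hs Hsol) as Hsm.
  exists (RtoC (1 / M * s)); split; [do 2 eexists; exact He|split].
  + simpl; apply Rmult_lt_0_compat; auto; apply Rdiv_lt_0_compat; lra.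
  + do 3 eexists; split; [|split; [|split; [exact Hr|split; [|split; [exact Ho|exact He]]]]].
    * discriminate.
    * apply smooth_profile_diffn; intros n; apply (Hsm n).
    * apply smooth_profile_diffn; intros n; apply (Hsm n).
Qed.
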